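(* Let $\zeta_{1,1}(s)=-\,\frac{4s}{(1-s)^2}$. Then for all $a\in\mathbb{C}$, $\ell\in\mathbb{Z}$ and $\kappa=0,1$, one has near $s=1$ $${}_2F_{1}\left(\begin{array}{l}-a+\ell+\frac\kappa2,\,a+\frac\kappa2\\ \frac12+\kappa\end{array}\mid\frac1{\zeta_{1,1}(s)}\right)=\frac{(-1)^\kappa(a+\kappa/2)_{1-\ell-\kappa}}{(a)_{1-\ell}}\left[-\zeta_{1,1}(s)/4\right]^{\kappa/2}\cdot\tfrac12\left[s^a\,F_\ell\left(-a,\tfrac12;\,s^{-1}\right)+(-1)^\kappa s^{-a}\,F_\ell\left(-a,\tfrac12;\,s\right)\right].$$ Moreover, for all $a,c\in\mathbb{C}$, $\ell=0,1$ and $\kappa=0,1$, one has near $s=1$ $${}_{3}F_{2}\left(\begin{array}{l}-a+\ell+1+\frac\kappa2,\,a+\frac\kappa2;\ -a-c+\ell+\frac\kappa2\\ \tfrac12+\kappa;\ -a-c+\ell+1+\frac\kappa2\end{array}\mid\frac1{\zeta_{1,1}(s)}\right)$$ $$=\frac{(-1)^\kappa(a+\kappa/2)_{-\ell-\kappa}(a+c-\ell-\kappa/2)}{(a)_{-\ell}(a+c-\ell)}\left[-\zeta_{1,1}(s)/4\right]^{\kappa/2}\cdot\tfrac12\left[s^a\,G_\ell\left(-a,\tfrac12,-c;\,s^{-1}\right)+(-1)^\kappa s^{-a}\,G_\ell\left(-a,\tfrac12,-c;\,s\right)\right].$$ Here $a$ (and $c$) are assumed to be such that no lower hypergeometric parameter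 is a non-positive integer and no division by zero occurs.
   Context: Branches: complex powers of $s$ near $1$ are principal, and $[-\zeta_{1,1}(s)/4]^{1/2}=s^{1/2}/(1-s)$. Notation: ${}_{m}F_{m-1}(a_1,\dots,a_m;b_1,\dots,b_{m-1};\zeta)=\sum_{k\ge0}\frac{(a_1)_k\cdots(a_m)_k}{(b_1)_k\cdots(b_{m-1})_k(1)_k}\zeta^k$. For $c\in\mathbb{C}$, $(c)_r=c(c+1)\cdots(c+r-1)$ for $r\ge0$ and $(c)_{-s}=[(c-s)\cdots(c-1)]^{-1}$ for $s\ge0$; $\binom{c}{r}=(c-r+1)_r/r!$. Rational functions $F_\ell$: for $\ell\in\mathbb{Z}$ and $B\ne0,1$ let $f_\ell(A,B;k)=\frac{(A+Bk+1)_{\ell-1}}{(A+1)_{\ell-1}}$ and $\hat f_\ell(A,B;r)=\sum_{k=0}^r(-1)^k\binom{r}{k}\binom{A+Bk}{r}f_\ell(A,B;k)$. Then $F_\ell(A,B;y)$ is the rational function of $y$ given near $y=1$ by $\sum_{r\ge0}\hat f_\ell(A,B;r)\left(\frac{1-y}{y}\right)^r$. E.g. $F_0\equiv1$, $F_1(A,B;y)=\frac{y}{(1-B)y+B}$. Functions $G_0,G_1$: $G_0(A,B,C;y)={}_2F_1\left(C,1;\frac{A+C}B+1;\frac{y-1}y\right)$ and $G_1(A,B,C;y)=\frac{y}{(1-B)y+B}\;{}_3F_2\left(C,\frac{A+1}{B-1}+1,1;\frac{A+C+1}{B}+1,\frac{A+1}{B-1};\frac{y-1}y\right)$. *)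

(* Defs.v *)
From Stdlib Require Export Reals ZArith List ClassicalEpsilon.
From Coquelicot Require Export Coquelicot.
Export ListNotations.
Open Scope C_scope.

Definition Cexp (z : C) : C :=
  (exp (Re z) * cos (Im z), exp (Re z) * sin (Im z))%R.

(* Principal argument off the cut (-oo, 0], by the half-angle formula
   tan (theta / 2) = sin theta / (1 + cos theta). *)
Definition Carg (z : C) : R := (2 * atan (Im z / (Cmod z + Re z)))%R.

Definition Clog (z : C) : C := (ln (Cmod z), Carg z).

Definition Cpower (z w : C) : C := Cexp (w * Clog z).

Definition CSeries (u : nat -> C) : C :=
  (Series (fun n => Re (u n)), Series (fun n => Im (u n))).

Definition CofNat (n : nat) : C := RtoC (INR n).
Definition CofZ (n : Z) : C := RtoC (IZR n).

Fixpoint poch (c : C) (n : nat) : C :=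
  match n with
  | O => 1
  | S m => poch c m * (c + CofNat m)
  end.

(* (c)_n for n in Z; for n = -s < 0 note that (c-s)...(c-1) = (c-s)_s. *)
Definition pochZ (c : C) (n : Z) : C :=
  if (0 <=? n)%Z then poch c (Z.to_nat n)
  else / poch (c + CofZ n) (Z.to_nat (- n)).

Definition pochZ_defined (c : C) (n : Z) : Prop :=
  (n < 0)%Z -> poch (c + CofZ n) (Z.to_nat (- n)) <> 0.

Definition binom (c : C) (r : nat) : C :=
  poch (c - CofNat r + 1) r / CofNat (fact r).

Definition poch_prod (cs : list C) (k : nat) : C :=
  fold_right (fun c p => poch c k * p) 1 cs.

(* mF(m-1)(a_1, ..., a_m; b_1, ..., b_(m-1); z) *)
Definition hypF (aa bb : list C) (z : C) : C :=
  CSeries (fun k =>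
    poch_prod aa k / (poch_prod bb k * poch 1 k) * Cpow z k).

Definition lower_ok (bb : list C) : Prop :=
  forall b : C, In b bb -> forall n : nat, b <> - CofNat n.

Definition fl (l : Z) (A B : C) (k : nat) : C :=
  pochZ (A + B * CofNat k + 1) (l - 1) / pochZ (A + 1) (l - 1).

Definition fhat_sum (l : Z) (A B : C) (r : nat) : C :=
  sum_n (G := C_AbelianMonoid)
    (fun k => Cpow (-1) k * binom (CofNat r) k
              * binom (A + B * CofNat k) r * fl l A B k) r.

(* fhat_sum l A B r is a rational function of A.  Its value v at A is taken
   with removable singularities removed: for l <= 0, fl has poles in A, some of
   which are cancelled by the binomial factor or in the sum (already for
   F_0 = 1 when A = -B).  Where no denominator in fhat_sum vanishes, v is
   fhat_sum l A B r itself. *)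
Definition is_fhat (l : Z) (A B : C) (r : nat) (v : C) : Prop :=
  filterlim (fun A' : C => fhat_sum l A' B r)
            (locally' (T := C_UniformSpace) A)
            (locally (T := C_UniformSpace) v).

Definition F_defined (l : Z) (A B : C) : Prop :=
  forall r : nat, exists v : C, is_fhat l A B r v.

(* Coefficient lists, constant term first. *)
Definition Cpoly_eval (p : list C) (y : C) : C :=
  fold_right (fun c q => c + y * q) 0 p.

(* The rational function pq.1 / pq.2 represents F_l(A,B;.). *)
Definition is_F (l : Z) (A B : C) (pq : list C * list C) : Prop :=
  exists h : nat -> C,
    (forall r : nat, is_fhat l A B r (h r)) /\
    locally (T := C_UniformSpace) (RtoC 1) (fun y : C =>
      Cpoly_eval (snd pq) y <> 0 /\
      is_series (K := C_AbsRing) (V := C_NormedModule)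
        (fun r => h r * Cpow ((1 - y) / y) r)
        (Cpoly_eval (fst pq) y / Cpoly_eval (snd pq) y)).

Definition F (l : Z) (A B y : C) : C :=
  let pq := epsilon (inhabits (nil, nil)) (is_F l A B) in
  Cpoly_eval (fst pq) y / Cpoly_eval (snd pq) y.

Definition G_lower (l : Z) (A B D : C) : list C :=
  if (l =? 0)%Z then [(A + D) / B + 1]
  else [(A + D + 1) / B + 1; (A + 1) / (B - 1)].

(* G_0 for l = 0 and G_1 for l = 1. *)
Definition G (l : Z) (A B D y : C) : C :=
  if (l =? 0)%Z then hypF [D; RtoC 1] (G_lower l A B D) ((y - 1) / y)
  else y / ((1 - B) * y + B)
       * hypF [D; (A + 1) / (B - 1) + 1; RtoC 1] (G_lower l A B D)
              ((y - 1) / y).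

(* At the pole s = 1 the convention / 0 = 0 gives the correct value
   1 / zeta11 1 = 0. *)
Definition zeta11 (s : C) : C := - (4 * s / Cpow (1 - s) 2).

(* The branch of [- zeta11 s / 4]^(1/2) near s = 1. *)
Definition sqrt_zeta11 (s : C) : C := Cpower s (1 / 2) / (1 - s).

(* Main.v *)
(* For any weights f put w_k = binom(A + B k, k) f(k) and
   h_r = sum_k (-1)^k binom(r, k) binom(A + B k, r) f(k).  Expanding powers of
   1 + u = 1 / y by the binomial series and exchanging the two summations gives
     sum_r h_r u^r = y^(-A) sum_k w_k x^k,  u = (1 - y) / y, x = (y - 1) y^(-B).
   For f = f_l the left side is F_l(A, B; y).  For f = f_(l+1)(k) g / (g + B k),
   g = A + C + l, a first-order recurrence in r identifies it with
   G_l(A, B, C; y).  When B = 1/2, replacing y by 1 / y changes x into - x, so the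
   two combinations on the right of the theorem are the even and odd parts of
   sum_k w_k x^k; since x^2 = - 4 / zeta11, these are the hypergeometric series on
   the left, term by term. *)
Require Import Defs.
From Stdlib Require Import Lra Lia FunctionalExtensionality.

(** * Complex series *)

(** [F] is a chosen rational function whose coefficients in [u] are limits in [A], so two things are
    owed before its series can be used. The coefficients must be known at the given [A]: off
    finitely many points the products [binom * fl] equal [series_coef], whose only possible pole
    sits in the single number [w_1]; for [l <= 0] the regularity of the first coefficient rules it
    out. A representing rational function must also exist: for [l > 0], multiplying the weights by
    [k] keeps the generating function a polynomial over a power of [1 + B u], while for [l <= 0] the
    coefficients with [r > -l] are differences of polynomials of too low degree and vanish.

    The exchange of summations is justified by a geometric majorant of the double series, which is
    why growth bounds on [w] and on binomial coefficients with growing upper argument are needed.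

    For [kappa = 1] the prefactor in the theorem is exactly [1 / w_1], and the square root is
    [1 / x]: together they normalize the odd part to start with 1. *)

Definition Csum (f : nat -> C) (n : nat) : C :=
  sum_n (G := C_AbelianMonoid) f n.

Notation is_Cseries := (@is_series C_AbsRing C_NormedModule).

Lemma Csum_O (f : nat -> C) : Csum f 0 = f 0%nat.
Proof. exact (sum_O f). Qed.

Lemma Csum_S (f : nat -> C) (n : nat) : Csum f (S n) = Csum f n + f (S n).
Proof. exact (sum_Sn f n). Qed.

Lemma Csum_ext (f g : nat -> C) (n : nat) :
  (forall k, (k <= n)%nat -> f k = g k) -> Csum f n = Csum g n.
Proof. exact (sum_n_ext_loc f g n). Qed.

Lemma Csum_plus (f g : nat -> C) (n : nat) :
  Csum (fun k => f k + g k) n = Csum f n + Csum g n.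
Proof. exact (sum_n_plus f g n). Qed.

Lemma Csum_scal (c : C) (f : nat -> C) (n : nat) :
  Csum (fun k => c * f k) n = c * Csum f n.
Proof. exact (sum_n_mult_l (K := C_Ring) c f n). Qed.

Lemma Csum_shift (f : nat -> C) (n : nat) :
  Csum f (S n) = f O + Csum (fun k => f (S k)) n.
Proof.
induction n as [|n IH].
- rewrite Csum_S, !Csum_O; ring.
- rewrite Csum_S, IH, (Csum_S (fun k => f (S k))); ring.
Qed.

Lemma Csum_antidiagonal (t : nat -> nat -> C) (n : nat) :
  Csum (fun r => Csum (fun k => t k (r - k)%nat) r) n
  = Csum (fun k => Csum (t k) (n - k)) n.
Proof.
induction n as [|n IH].
- rewrite !Csum_O; reflexivity.
- rewrite !Csum_S, IH, Nat.sub_diag, Csum_O, Cplus_assoc, <- Csum_plus.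
  f_equal; apply Csum_ext; intros k Hk.
  replace (S n - k)%nat with (S (n - k)) by lia.
  now rewrite Csum_S.
Qed.

Lemma Cmod_Csum (f : nat -> C) (g : nat -> R) (n : nat) :
  (forall k, (k <= n)%nat -> Cmod (f k) <= g k)%R ->
  (Cmod (Csum f n) <= sum_n g n)%R.
Proof.
induction n as [|n IH]; intros H.
- rewrite Csum_O, sum_O; auto.
- rewrite Csum_S, sum_Sn.
  eapply Rle_trans; [apply Cmod_triangle|].
  apply Rplus_le_compat; auto.
Qed.

Lemma is_Cseries_epsilon (u : nat -> C) (l : C) :
  is_Cseries u l <->
  (forall eps : R, (0 < eps)%R ->
     exists N, forall n, (N <= n)%nat -> (Cmod (Csum u n - l) < eps)%R).
Proof.
split.
- intros H eps He.
  assert (H1 := proj1 (filterlim_locally_ball_norm (K := C_AbsRing)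
            (U := C_NormedModule) (Csum u) l) H (mkposreal eps He)).
  destruct H1 as [N HN]; exists N; intros n Hn.
  exact (HN n Hn).
- intros H.
  apply (proj2 (filterlim_locally_ball_norm (K := C_AbsRing)
            (U := C_NormedModule) (Csum u) l)).
  intros [eps He]; destruct (H eps He) as [N HN].
  exists N; intros n Hn; exact (HN n Hn).
Qed.

Lemma is_Cseries_unique (u : nat -> C) (l1 l2 : C) :
  is_Cseries u l1 -> is_Cseries u l2 -> l1 = l2.
Proof.
intros H1 H2.
exact (filterlim_locally_unique (Csum u) l1 l2 H1 H2).
Qed.

Lemma is_Cseries_plus (u v : nat -> C) (a b : C) :
  is_Cseries u a -> is_Cseries v b -> is_Cseries (fun n => u n + v n) (a + b).
Proof. exact (is_series_plus u v a b). Qed.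

Lemma is_Cseries_scal (c : C) (u : nat -> C) (a : C) :
  is_Cseries u a -> is_Cseries (fun n => c * u n) (c * a).
Proof. exact (is_series_scal c u a). Qed.

Lemma is_Cseries_ext (u v : nat -> C) (a : C) :
  (forall n, u n = v n) -> is_Cseries u a -> is_Cseries v a.
Proof. exact (is_series_ext u v a). Qed.

(** On coefficient sequences this is multiplication of the generating function by its variable. *)
Definition shift_seq (u : nat -> C) (n : nat) : C :=
  match n with O => 0 | S m => u m end.

Lemma is_Cseries_shift (u : nat -> C) (a : C) :
  is_Cseries u a -> is_Cseries (shift_seq u) a.
Proof.
intros H; apply is_Cseries_epsilon; intros eps He.
destruct (proj1 (is_Cseries_epsilon u a) H eps He) as [N HN].
exists (S N); intros [|n] Hn; [lia|].
rewrite Csum_shift; simpl.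
replace (0 + Csum (fun k => u k) n - a) with (Csum u n - a)
  by (change (Csum (fun k => u k) n) with (Csum u n); ring).
apply HN; lia.
Qed.

Lemma is_Cseries_finite (u : nat -> C) (N : nat) :
  (forall n, (N < n)%nat -> u n = 0) -> is_Cseries u (Csum u N).
Proof.
intros H; apply is_Cseries_epsilon; intros eps He; exists N; intros n Hn.
replace (Csum u n) with (Csum u N).
- unfold Cminus; rewrite Cplus_opp_r, Cmod_0; exact He.
- induction Hn as [|n Hn IH]; [reflexivity|].
  rewrite Csum_S, <- IH, (H (S n)) by lia; ring.
Qed.

Lemma Re_Csum (u : nat -> C) (n : nat) :
  Re (Csum u n) = sum_n (fun k => Re (u k)) n.
Proof.
induction n as [|n IH]; [now rewrite Csum_O, sum_O|].
now rewrite Csum_S, sum_Sn, <- IH.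
Qed.

Lemma is_Cseries_Re (u : nat -> C) (a : C) :
  is_Cseries u a -> is_series (fun n => Re (u n)) (Re a).
Proof.
intros H.
change (is_lim_seq (sum_n (fun n => Re (u n))) (Re a)).
apply is_lim_seq_spec; intros [eps He]; simpl.
destruct (proj1 (is_Cseries_epsilon u a) H eps He) as [N HN].
exists N; intros n Hn.
eapply Rle_lt_trans; [|apply (HN n Hn)].
replace (sum_n (fun n => Re (u n)) n - Re a)%R with (Re (Csum u n - a));
  [apply re_le_Cmod|].
rewrite <- Re_Csum; reflexivity.
Qed.

Lemma is_Cseries_Im (u : nat -> C) (a : C) :
  is_Cseries u a -> is_series (fun n => Im (u n)) (Im a).
Proof.
intros H.
apply is_series_ext with (fun n => Re (- Ci * u n)).
- intros n; destruct (u n); simpl; ring.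
- replace (Im a) with (Re (- Ci * a)) by (destruct a; simpl; ring).
  apply is_Cseries_Re, is_Cseries_scal, H.
Qed.

Lemma CSeries_unique (u : nat -> C) (a : C) : is_Cseries u a -> CSeries u = a.
Proof.
intros H; unfold CSeries.
rewrite (is_series_unique _ _ (is_Cseries_Re _ _ H)).
rewrite (is_series_unique _ _ (is_Cseries_Im _ _ H)).
now destruct a.
Qed.

(** * Geometric majorants and the exchange of summations *)

Definition geom_dominated (u : nat -> C) : Prop :=
  exists M K : R, (0 <= M)%R /\ (0 <= K)%R /\
    forall n, (Cmod (u n) <= M * K ^ n)%R.

Lemma sum_geom_le (q : R) (n : nat) :
  (0 <= q < 1)%R -> (sum_n (fun j => q ^ j) n <= / (1 - q))%R.
Proof.
intros Hq.
assert (H : (sum_n (fun j => q ^ j) n * (1 - q) = 1 - q ^ S n)%R).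
{ induction n as [|n IH]; [rewrite sum_O; simpl; ring|].
  rewrite sum_Sn; unfold plus; simpl in *; rewrite Rmult_plus_distr_r, IH; ring. }
apply Rmult_le_reg_r with (1 - q)%R; [lra|].
rewrite H, Rinv_l by lra.
assert (0 <= q ^ S n)%R by (apply pow_le; lra); lra.
Qed.

Lemma ex_Cseries_geom (u : nat -> C) (M q : R) :
  (0 <= q < 1)%R -> (forall n, Cmod (u n) <= M * q ^ n)%R ->
  exists a, is_Cseries u a.
Proof.
intros Hq H.
apply (ex_series_le (K := C_AbsRing) (V := C_CompleteNormedModule) u
         (fun n => M * q ^ n)%R H).
apply (ex_series_scal_l M (fun n => q ^ n)%R), ex_series_geom.
rewrite Rabs_pos_eq; lra.
Qed.

Lemma Csum_tail_geom (u : nat -> C) (D q : R) (m d : nat) :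
  (0 <= D)%R -> (0 <= q < 1)%R -> (forall n, Cmod (u n) <= D * q ^ n)%R ->
  (Cmod (Csum u (m + d) - Csum u m) <= D * q ^ m / (1 - q))%R.
Proof.
intros HD Hq H.
assert (E : forall d, Csum u (m + S d) - Csum u m
            = Csum (fun j => u (m + S j)%nat) d).
{ clear d; induction d as [|d IH].
  - replace (m + 1)%nat with (S m) by lia.
    rewrite Csum_S, Csum_O; replace (m + 1)%nat with (S m) by lia; ring.
  - rewrite (Csum_S _ d), <- IH.
    replace (m + S (S d))%nat with (S (m + S d)) by lia.
    rewrite Csum_S; ring. }
assert (P := pow_le q m ltac:(lra)).
assert (0 <= D * q ^ m / (1 - q))%R.
{ apply Rmult_le_pos; [now apply Rmult_le_pos|].
  left; apply Rinv_0_lt_compat; lra. }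
destruct d as [|d].
- rewrite Nat.add_0_r; unfold Cminus; rewrite Cplus_opp_r, Cmod_0; lra.
- rewrite E.
  eapply Rle_trans;
    [apply (Cmod_Csum _ (fun j => (D * q ^ m) * q ^ j)%R)|].
  + intros j _.
    eapply Rle_trans; [apply H|].
    rewrite Rmult_assoc; apply Rmult_le_compat_l; [exact HD|].
    rewrite pow_add; apply Rmult_le_compat_l; [exact P|].
    simpl; assert (Pj := pow_le q j ltac:(lra)); nra.
  + rewrite (sum_n_mult_l (K := R_Ring)).
    change (mult (K := R_Ring)) with Rmult; unfold Rdiv.
    apply Rmult_le_compat_l; [now apply Rmult_le_pos|].
    now apply sum_geom_le.
Qed.

Lemma Cseries_tail_geom (u : nat -> C) (a : C) (D q : R) (m : nat) :
  (0 <= D)%R -> (0 <= q < 1)%R -> (forall n, Cmod (u n) <= D * q ^ n)%R ->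
  is_Cseries u a ->
  (Cmod (Csum u m - a) <= D * q ^ m / (1 - q))%R.
Proof.
intros HD Hq H Ha; apply le_epsilon; intros eps He.
destruct (proj1 (is_Cseries_epsilon u a) Ha eps He) as [N HN].
replace (Csum u m - a)
  with (- (Csum u (m + N) - Csum u m) + (Csum u (m + N) - a)) by ring.
eapply Rle_trans; [apply Cmod_triangle|]; rewrite Cmod_opp.
apply Rplus_le_compat; [now apply Csum_tail_geom|].
left; apply HN; lia.
Qed.

Lemma Cseries_bound_geom (u : nat -> C) (a : C) (D q : R) :
  (0 <= D)%R -> (0 <= q < 1)%R -> (forall n, Cmod (u n) <= D * q ^ n)%R ->
  is_Cseries u a -> (Cmod a <= 2 * D / (1 - q))%R.
Proof.
intros HD Hq H Ha.
assert (H1 := Cseries_tail_geom u a D q 0 HD Hq H Ha).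
assert (H0 := H O); rewrite Csum_O in H1; simpl in H0, H1.
replace a with (u O + - (u O - a)) by ring.
eapply Rle_trans; [apply Cmod_triangle|]; rewrite Cmod_opp.
assert (1 <= / (1 - q))%R by
  (rewrite <- Rinv_1 at 1; apply Rinv_le_contravar; lra).
unfold Rdiv in *; nra.
Qed.

(** These are the terms of the derived geometric series, whose radius of convergence is still at
    least 1. The factor [S n] will count the rows of a triangular sum. *)
Lemma is_lim_seq_n_pow (q : R) :
  (0 <= q < 1)%R -> is_lim_seq (fun n => INR (S n) * q ^ n)%R 0.
Proof.
intros Hq.
destruct (Req_dec q 0) as [->|Hq0].
{ apply is_lim_seq_incr_1; apply is_lim_seq_ext with (fun _ => 0%R).
  - intros n; simpl; ring.
  - apply is_lim_seq_const. }
apply ex_series_lim_0.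
apply (ex_series_ext (fun n => PS_derive (fun _ => 1%R) n * q ^ n)%R).
- intros n; unfold PS_derive; now rewrite Rmult_1_r.
- apply ex_series_Rabs, CV_disk_inside.
  rewrite CV_radius_derive.
  apply Rbar_lt_le_trans with 1%R; [simpl; rewrite Rabs_pos_eq; lra|].
  apply CV_radius_bounded; exists 1%R; intros n.
  rewrite pow1, Rmult_1_r, Rabs_R1; lra.
Qed.

(** Truncating row [k] after the index [n - k] leaves an error of at most [D q^k q^(n-k) / (1 - q)],
    which does not depend on [k]; the [n + 1] rows together contribute [(n + 1) D q^n / (1 - q)],
    which tends to 0. *)
Lemma is_Cseries_antidiagonal (t : nat -> nat -> C) (R0 : nat -> C) (L : C)
  (D q : R) :
  (0 <= D)%R -> (0 <= q < 1)%R ->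
  (forall k j, Cmod (t k j) <= D * q ^ (k + j))%R ->
  (forall k, is_Cseries (t k) (R0 k)) ->
  is_Cseries R0 L ->
  is_Cseries (fun r => Csum (fun k => t k (r - k)%nat) r) L.
Proof.
intros HD Hq H HR HL; apply is_Cseries_epsilon; intros eps He.
destruct (proj1 (is_Cseries_epsilon R0 L) HL (eps / 2)%R ltac:(lra)) as [N1 HN1].
assert (H0 := is_lim_seq_n_pow q Hq).
apply (is_lim_seq_scal_l _ (D / (1 - q))) in H0.
rewrite Rbar_mult_0_r in H0.
apply is_lim_seq_spec in H0.
destruct (H0 (mkposreal (eps / 2)%R ltac:(lra))) as [N2 HN2]; cbn [pos] in HN2.
exists (N1 + N2)%nat; intros n Hn.
rewrite Csum_antidiagonal.
replace (Csum (fun k => Csum (t k) (n - k)) n - L) with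
  (Csum (fun k => Csum (t k) (n - k) - R0 k) n + (Csum R0 n - L)).
2:{ rewrite (Csum_ext (fun k => Csum (t k) (n - k) - R0 k)
      (fun k => Csum (t k) (n - k) + (-1) * R0 k)) by (intros; ring).
    rewrite Csum_plus, Csum_scal; change (Csum (fun k => R0 k) n) with (Csum R0 n).
    ring. }
eapply Rle_lt_trans; [apply Cmod_triangle|].
replace eps with (eps / 2 + eps / 2)%R by field.
apply Rplus_le_lt_compat; [|apply HN1; lia].
eapply Rle_trans; [apply (Cmod_Csum _ (fun _ => D * q ^ n / (1 - q))%R)|].
- intros k Hk.
  replace (D * q ^ n)%R with ((D * q ^ k) * q ^ (n - k))%R
    by (rewrite Rmult_assoc, <- pow_add; do 2 f_equal; lia).
  apply Cseries_tail_geom; auto.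
  + apply Rmult_le_pos; [exact HD|apply pow_le; lra].
  + intros j; rewrite Rmult_assoc, <- pow_add; apply H.
- rewrite sum_n_const; left.
  eapply Rle_lt_trans; [|apply (HN2 n); lia].
  rewrite Rminus_0_r; eapply Rle_trans; [|apply Rle_abs].
  apply Req_le; unfold Rdiv; ring.
Qed.

Lemma Cmult_cancel_r (c a b : C) : c <> 0 -> a * c = b * c -> a = b.
Proof.
intros Hc H; replace a with (a * c / c) by (field; exact Hc).
rewrite H; field; exact Hc.
Qed.

(** * Complex exponential and logarithm *)

Lemma Copp_opp (z : C) : - - z = z.
Proof. ring. Qed.

Lemma Cinv_0 : / 0 = 0 :> C.
Proof. unfold Cinv, RtoC; simpl; f_equal; unfold Rdiv; ring. Qed.

Lemma Cexp_0 : Cexp 0 = 1.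
Proof. unfold Cexp; simpl; rewrite exp_0, cos_0, sin_0; unfold RtoC; f_equal; ring. Qed.

Lemma Cexp_plus (z w : C) : Cexp (z + w) = Cexp z * Cexp w.
Proof.
destruct z as [a b], w as [c d]; unfold Cexp, Cmult; simpl.
rewrite exp_plus, cos_plus, sin_plus; f_equal; ring.
Qed.

Lemma Cexp_opp_l (z : C) : Cexp (- z) * Cexp z = 1.
Proof. rewrite <- Cexp_plus, <- Cexp_0; f_equal; ring. Qed.

Lemma Cexp_neq_0 (z : C) : Cexp z <> 0.
Proof.
intros H; apply C1_nz; rewrite <- (Cexp_opp_l z), H; ring.
Qed.

Lemma Cexp_opp (z : C) : Cexp (- z) = / Cexp z.
Proof.
apply (Cmult_cancel_r (Cexp z)); [apply Cexp_neq_0|].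
rewrite Cexp_opp_l, Cinv_l; [reflexivity|apply Cexp_neq_0].
Qed.

Lemma CofNat_S (n : nat) : CofNat (S n) = CofNat n + 1.
Proof. unfold CofNat; now rewrite S_INR, RtoC_plus. Qed.

Lemma CofNat_plus (n m : nat) : CofNat (n + m) = CofNat n + CofNat m.
Proof. unfold CofNat; now rewrite plus_INR, RtoC_plus. Qed.

Lemma CofNat_mult (n m : nat) : CofNat (n * m) = CofNat n * CofNat m.
Proof. unfold CofNat; now rewrite mult_INR, RtoC_mult. Qed.

Lemma CofNat_0 : CofNat 0 = 0.
Proof. reflexivity. Qed.

Lemma CofNat_inj (n m : nat) : CofNat n = CofNat m -> n = m.
Proof. intros H; apply INR_eq, RtoC_inj, H. Qed.

Lemma CofNat_neq_0 (n : nat) : CofNat (S n) <> 0.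
Proof. intros H; apply (CofNat_inj (S n) 0) in H; discriminate. Qed.

Lemma Cmod_CofNat (n : nat) : Cmod (CofNat n) = INR n.
Proof. unfold CofNat; rewrite Cmod_R; apply Rabs_pos_eq, pos_INR. Qed.

Lemma Cexp_pow (z : C) (n : nat) : Cpow (Cexp z) n = Cexp (CofNat n * z).
Proof.
induction n as [|n IH].
- rewrite CofNat_0, Cmult_0_l, Cexp_0; reflexivity.
- rewrite Cpow_S, IH, <- Cexp_plus, CofNat_S; f_equal; ring.
Qed.

Lemma Re_pos_neq_0 (z : C) : (0 < Re z)%R -> z <> 0.
Proof. intros H E; rewrite E in H; simpl in H; lra. Qed.

Lemma Cmod_sq (z : C) : (Cmod z * Cmod z = Re z * Re z + Im z * Im z)%R.
Proof. assert (H := Cmod2_alt z); simpl in H; lra. Qed.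

Lemma Clog_inv (z : C) : (0 < Re z)%R -> Clog (/ z) = - Clog z.
Proof.
intros H; assert (Hz := Re_pos_neq_0 z H).
assert (Hm := proj1 (Cmod_gt_0 z) Hz).
unfold Clog, Carg; rewrite Cmod_inv by exact Hz.
assert (Hs := Cmod_sq z).
unfold Copp; simpl; f_equal; [now rewrite ln_Rinv|].
rewrite <- Ropp_mult_distr_r_reverse, <- atan_opp; do 2 f_equal.
destruct z as [x y]; simpl in *.
replace (x * (x * 1) + y * (y * 1))%R with (Cmod (x, y) * Cmod (x, y))%R by lra.
field; repeat split; lra.
Qed.

(** With [v = tan (theta / 2)] the double-angle formulas apply. They close up because
    [y^2 = (|z| - x)(|z| + x)], that is [v^2 (|z| + x) = |z| - x], whence
    [(1 + v^2)(|z| + x) = 2 |z|]. *)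
Lemma Cexp_Clog (z : C) : (0 < Re z)%R -> Cexp (Clog z) = z.
Proof.
intros H; assert (Hz := Re_pos_neq_0 z H).
assert (Hm := proj1 (Cmod_gt_0 z) Hz).
assert (Hs := Cmod_sq z).
unfold Cexp, Clog, Carg; simpl; rewrite exp_ln by exact Hm.
set (v := (Im z / (Cmod z + Re z))%R).
assert (Hv : ((Cmod z + Re z) * v = Im z)%R) by (unfold v; field; lra).
rewrite cos_2a, sin_2a, cos_atan, sin_atan.
assert (Hq : (0 < 1 + v²)%R) by (unfold Rsqr; nra).
assert (Hsq := sqrt_sqrt _ (Rlt_le _ _ Hq)).
assert (Hp := sqrt_lt_R0 _ Hq).
set (w := sqrt (1 + v²)) in *.
assert (HA : (v * v * (Cmod z + Re z) = Cmod z - Re z)%R).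
{ apply Rmult_eq_reg_r with (Cmod z + Re z)%R; [|lra].
  replace (v * v * (Cmod z + Re z) * (Cmod z + Re z))%R
    with (((Cmod z + Re z) * v) * ((Cmod z + Re z) * v))%R by ring.
  rewrite Hv; lra. }
assert (Hw : (w * w * (Cmod z + Re z) = 2 * Cmod z)%R).
{ rewrite Hsq; unfold Rsqr; rewrite Rmult_plus_distr_r, HA; ring. }
destruct z as [x y]; simpl in *; f_equal.
- transitivity (Cmod (x, y) * (1 - v * v) / (w * w))%R; [field; lra|].
  apply Rmult_eq_reg_r with (w * w * (Cmod (x, y) + x))%R; [|rewrite Hw; lra].
  transitivity (Cmod (x, y) * (Cmod (x, y) + x - v * v * (Cmod (x, y) + x)))%R;
    [field; lra|rewrite HA, Hw; ring].
- transitivity (Cmod (x, y) * (2 * v) / (w * w))%R; [field; lra|].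
  apply Rmult_eq_reg_r with (w * w * (Cmod (x, y) + x))%R; [|rewrite Hw; lra].
  transitivity (Cmod (x, y) * 2 * ((Cmod (x, y) + x) * v))%R;
    [field; lra|rewrite Hv, Hw; ring].
Qed.

(** Derivatives in a real parameter suffice, because functions are only differentiated along a
    ray. *)
Definition is_Cderive (f : R -> C) (t : R) (d : C) : Prop :=
  is_derive (fun t => Re (f t)) t (Re d) /\
  is_derive (fun t => Im (f t)) t (Im d).

(** With [s = -1] this is the real part of the complex product rule, with [s = 1] the imaginary
    part. *)
Lemma is_derive_mult_plus (f1 f2 g1 g2 : R -> R) (s t a1 a2 b1 b2 : R) :
  is_derive f1 t a1 -> is_derive f2 t a2 ->
  is_derive g1 t b1 -> is_derive g2 t b2 ->
  is_derive (fun t => f1 t * g1 t + s * (f2 t * g2 t))%R t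
    (a1 * g1 t + f1 t * b1 + s * (a2 * g2 t + f2 t * b2))%R.
Proof.
intros F1 F2 G1 G2.
auto_derive; [repeat split; eexists; eassumption|].
rewrite (is_derive_unique (fun x : R => f1 x) _ _ F1), (is_derive_unique (fun x : R => f2 x) _ _ F2),
  (is_derive_unique (fun x : R => g1 x) _ _ G1), (is_derive_unique (fun x : R => g2 x) _ _ G2); ring.
Qed.

Lemma is_Cderive_mult (f g : R -> C) (t : R) (df dg : C) :
  is_Cderive f t df -> is_Cderive g t dg ->
  is_Cderive (fun t => f t * g t) t (df * g t + f t * dg).
Proof.
intros [F1 F2] [G1 G2]; split.
- assert (H := is_derive_mult_plus _ _ _ _ (-1) _ _ _ _ _ F1 F2 G1 G2).
  apply (is_derive_ext _ (fun t => Re (f t * g t))) in H;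
    [|intros x; simpl; unfold Re, Im; ring].
  eapply eq_rect; [exact H|]; simpl; unfold Re, Im; ring.
- assert (H := is_derive_mult_plus _ _ _ _ 1 _ _ _ _ _ F1 F2 G2 G1).
  apply (is_derive_ext _ (fun t => Im (f t * g t))) in H;
    [|intros x; simpl; unfold Re, Im; ring].
  eapply eq_rect; [exact H|]; simpl; unfold Re, Im; ring.
Qed.

Lemma is_Cderive_const (c : C) (t : R) : is_Cderive (fun _ => c) t 0.
Proof. split; apply (is_derive_const (K := R_AbsRing) (V := R_NormedModule)). Qed.

Lemma is_derive_exp_trig (f g : R -> R) (t a b : R) :
  is_derive f t a -> is_derive g t b ->
  is_derive (fun t => exp (f t) * cos (g t))%R t
    (a * (exp (f t) * cos (g t)) - b * (exp (f t) * sin (g t)))%R /\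
  is_derive (fun t => exp (f t) * sin (g t))%R t
    (a * (exp (f t) * sin (g t)) + b * (exp (f t) * cos (g t)))%R.
Proof.
intros F G; split; (auto_derive; [repeat split; eexists; eassumption|]);
  rewrite (is_derive_unique (fun x : R => f x) _ _ F), (is_derive_unique (fun x : R => g x) _ _ G); ring.
Qed.

Lemma is_Cderive_exp (f : R -> C) (t : R) (df : C) :
  is_Cderive f t df -> is_Cderive (fun t => Cexp (f t)) t (df * Cexp (f t)).
Proof.
intros [F1 F2]; destruct (is_derive_exp_trig _ _ _ _ _ F1 F2) as [H1 H2].
split; [exact H1|exact H2].
Qed.

Lemma is_Cderive_log (u : C) (t : R) :
  (0 < 1 + t * Re u)%R ->
  is_Cderive (fun t => Clog (1 + RtoC t * u)) t (u / (1 + RtoC t * u)).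
Proof.
intros H; destruct u as [a b].
change (0 < 1 + t * a)%R in H.
assert (E : forall t, 1 + RtoC t * (a, b) = (1 + t * a, t * b)%R).
{ intros x; unfold RtoC, Cplus, Cmult; simpl; f_equal; ring. }
assert (Q : (0 < (1 + t * a) ^ 2 + (t * b) ^ 2)%R) by (simpl; nra).
assert (S := sqrt_lt_R0 _ Q).
assert (SS := sqrt_sqrt _ (Rlt_le _ _ Q)).
split.
- apply is_derive_ext with
    (fun t => ln (sqrt ((1 + t * a) ^ 2 + (t * b) ^ 2))).
  { intros x; rewrite E; reflexivity. }
  rewrite E; unfold Cdiv, Cmult, Cinv, Re, Im, fst, snd.
  auto_derive; [tauto|].
  set (w := sqrt _) in *.
  apply Rmult_eq_reg_r with (w * w)%R; [|nra].
  rewrite SS at 2.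
  field; lra.
- apply is_derive_ext with
    (fun t => 2 * atan (t * b / (sqrt ((1 + t * a) ^ 2 + (t * b) ^ 2)
                                 + (1 + t * a))))%R.
  { intros x; rewrite E; reflexivity. }
  rewrite E; unfold Cdiv, Cmult, Cinv, Re, Im, fst, snd.
  simpl in *.
  auto_derive; [repeat split; lra|].
  set (w := sqrt _) in *.
  generalize dependent (1 + t * a)%R; intros X H Q w S SS.
  generalize dependent (t * b)%R; intros Y Q w S SS.
  rewrite <- SS.
  (* [w^2 = X^2 + Y^2] gives [(w + X)^2 + Y^2 = 2 w (w + X)]. *)
  assert (D : (1 + Y * / (w + X) * (Y * / (w + X) * 1) = 2 * w / (w + X))%R).
  { apply Rmult_eq_reg_r with ((w + X) * (w + X))%R; [|apply Rgt_not_eq; nra].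
    transitivity ((w + X) * (w + X) + Y * Y)%R; [field; lra|].
    transitivity (2 * w * (w + X))%R; [lra|field; lra]. }
  rewrite D.
  transitivity ((b * (w * (w + X)) - a * Y * (w + X) - b * (Y * Y))
                / (w * w * (w + X)))%R; [field; lra|].
  replace (Y * Y)%R with (w * w - X * X)%R by lra.
  field; lra.
Qed.

(** * Pochhammer symbols and binomial coefficients *)

Lemma poch_S (c : C) (n : nat) : poch c (S n) = poch c n * (c + CofNat n).
Proof. reflexivity. Qed.

Lemma poch_add (c : C) (n m : nat) :
  poch c (n + m) = poch c n * poch (c + CofNat n) m.
Proof.
induction m as [|m IH].
- rewrite Nat.add_0_r; simpl; ring.
- rewrite Nat.add_succ_r, !poch_S, IH, CofNat_plus; ring.
Qed.

Lemma poch_S_l (c : C) (n : nat) : poch c (S n) = c * poch (c + 1) n.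
Proof.
change (S n) with (1 + n)%nat; rewrite poch_add; simpl.
rewrite CofNat_0; change (CofNat 1) with (RtoC 1).
rewrite Cplus_0_r, Cmult_1_l; reflexivity.
Qed.

Lemma fact_neq_0_C (n : nat) : CofNat (fact n) <> 0.
Proof.
intros H; apply (CofNat_inj _ 0) in H; now apply fact_neq_0 in H.
Qed.

Lemma CofNat_fact_S (n : nat) :
  CofNat (fact (S n)) = (CofNat n + 1) * CofNat (fact n).
Proof.
rewrite <- CofNat_S, <- CofNat_mult; reflexivity.
Qed.

Lemma binom_S (c : C) (n : nat) :
  (CofNat n + 1) * binom c (S n) = (c - CofNat n) * binom c n.
Proof.
unfold binom; rewrite poch_S_l, CofNat_fact_S, CofNat_S.
replace (c - (CofNat n + 1) + 1) with (c - CofNat n) by ring.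
field; split; [apply fact_neq_0_C|].
rewrite <- CofNat_S; apply CofNat_neq_0.
Qed.

(** The binomial coefficient of [m + j] over [m] is at most [2^(m + j)]; the induction on the sum is
    Pascal's rule in the form [(m + j)! = m (m + j - 1)! + j (m + j - 1)!]. *)
Lemma fact_add_le (m j : nat) :
  (INR (fact (m + j)) <= 2 ^ (m + j) * (INR (fact m) * INR (fact j)))%R.
Proof.
assert (H : forall n m j, (m + j = n)%nat ->
  (INR (fact (m + j)) <= 2 ^ (m + j) * (INR (fact m) * INR (fact j)))%R);
  [|now apply (H (m + j)%nat)].
clear; induction n as [|n IH]; intros m j E.
{ replace m with 0%nat by lia; replace j with 0%nat by lia; simpl; lra. }
destruct m as [|m].
{ simpl (0 + j)%nat; simpl (fact 0); change (INR 1) with 1%R.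
  assert (1 <= 2 ^ j)%R by (apply pow_R1_Rle; lra).
  assert (P := INR_fact_lt_0 j); nra. }
destruct j as [|j].
{ rewrite Nat.add_0_r; simpl (fact 0); change (INR 1) with 1%R.
  assert (1 <= 2 ^ (S m))%R by (apply pow_R1_Rle; lra).
  assert (P := INR_fact_lt_0 (S m)); nra. }
assert (H1 := IH m (S j) ltac:(lia)).
assert (H2 := IH (S m) j ltac:(lia)).
replace (S m + S j)%nat with (S (m + S j)) by lia.
replace (S m + j)%nat with (m + S j)%nat in H2 by lia.
rewrite fact_simpl, mult_INR.
replace (INR (S (m + S j))) with (INR (S m) + INR (S j))%R
  by (rewrite <- plus_INR; f_equal; lia).
change (2 ^ S (m + S j))%R with (2 * 2 ^ (m + S j))%R.
rewrite (fact_simpl m), (fact_simpl j) in *; rewrite mult_INR in H1, H2 |- *.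
rewrite (mult_INR (S j)).
assert (P1 := pos_INR (S m)); assert (P2 := pos_INR (S j)).
rewrite Rmult_plus_distr_r.
apply (Rmult_le_compat_l _ _ _ P1) in H1.
apply (Rmult_le_compat_l _ _ _ P2) in H2.
lra.
Qed.

Lemma fact_mult_le (m j : nat) :
  (INR (fact m) * INR (fact j) <= INR (fact (m + j)))%R.
Proof.
induction j as [|j IH].
- rewrite Nat.add_0_r; simpl; lra.
- rewrite Nat.add_succ_r, !fact_simpl, !mult_INR.
  assert (INR (S j) <= INR (S (m + j)))%R by (apply le_INR; lia).
  assert (P := pos_INR (S j)); assert (Q := INR_fact_lt_0 (m + j)).
  nra.
Qed.

(** The factor [c + i] has modulus at most [m + i + 1], so the product is at most
    [(m + n)! / m!]. *)
Lemma Cmod_poch_le (c : C) (m n : nat) :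
  (Cmod c <= INR m)%R -> (Cmod (poch c n) <= 2 ^ (m + n) * INR (fact n))%R.
Proof.
intros H.
assert (Q := INR_fact_lt_0 m).
apply Rmult_le_reg_r with (INR (fact m)); [exact Q|].
eapply Rle_trans; [|apply Req_le; symmetry; rewrite Rmult_assoc,
  (Rmult_comm (INR (fact n))); reflexivity].
eapply Rle_trans; [|apply fact_add_le].
induction n as [|n IH].
- rewrite Nat.add_0_r; simpl; rewrite Cmod_1; lra.
- rewrite poch_S, Nat.add_succ_r, fact_simpl, mult_INR, Cmod_mult.
  assert (Cmod (c + CofNat n) <= INR (S (m + n)))%R.
  { eapply Rle_trans; [apply Cmod_triangle|].
    rewrite Cmod_CofNat, S_INR, plus_INR; lra. }
  assert (P1 := Cmod_ge_0 (c + CofNat n)); assert (P2 := Cmod_ge_0 (poch c n)).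
  assert (P3 := pos_INR (S (m + n))).
  rewrite (Rmult_comm (Cmod (poch c n))), Rmult_assoc.
  apply Rmult_le_compat; auto; apply Rmult_le_pos; lra.
Qed.

(** The argument is that for [poch]. That the exponent is linear in the bound [m] matters when [c]
    grows linearly with a summation index: the estimate then stays geometric in that index. *)
Lemma Cmod_binom_le (c : C) (m n : nat) :
  (Cmod c <= INR m)%R -> (Cmod (binom c n) <= 2 ^ (m + n))%R.
Proof.
intros H.
assert (Q := INR_fact_lt_0 m); assert (Qn := INR_fact_lt_0 n).
apply Rmult_le_reg_r with (INR (fact m) * INR (fact n))%R; [nra|].
eapply Rle_trans; [|apply fact_add_le]; clear Qn.
induction n as [|n IH].
- rewrite Nat.add_0_r; unfold binom; simpl poch.
  replace (1 / CofNat (fact 0)) with (RtoC 1)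
    by (change (CofNat (fact 0)) with (RtoC 1); field).
  rewrite Cmod_1; simpl; lra.
- assert (E : (Cmod (binom c (S n)) * INR (S n)
              = Cmod (c - CofNat n) * Cmod (binom c n))%R).
  { rewrite <- Cmod_mult, <- binom_S, Cmod_mult, <- CofNat_S, Cmod_CofNat; ring. }
  rewrite Nat.add_succ_r, (fact_simpl n), mult_INR, (fact_simpl (m + n)), mult_INR.
  assert (Cmod (c - CofNat n) <= INR (S (m + n)))%R.
  { eapply Rle_trans; [apply Cmod_triangle|].
    rewrite Cmod_opp, Cmod_CofNat, S_INR, plus_INR; lra. }
  assert (P1 := Cmod_ge_0 (c - CofNat n)); assert (P2 := Cmod_ge_0 (binom c n)).
  assert (P4 := INR_fact_lt_0 n).
  replace (Cmod (binom c (S n)) * (INR (fact m) * (INR (S n) * INR (fact n))))%R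
    with ((Cmod (binom c (S n)) * INR (S n)) * (INR (fact m) * INR (fact n)))%R
    by ring.
  rewrite E, Rmult_assoc.
  apply Rmult_le_compat; auto; repeat apply Rmult_le_pos; lra.
Qed.

(** * The binomial series *)

Lemma Im_Csum (u : nat -> C) (n : nat) :
  Im (Csum u n) = sum_n (fun k => Im (u k)) n.
Proof.
induction n as [|n IH]; [now rewrite Csum_O, sum_O|].
now rewrite Csum_S, sum_Sn, <- IH.
Qed.

Lemma Cmod_le_Re_Im (z : C) : (Cmod z <= Rabs (Re z) + Rabs (Im z))%R.
Proof.
replace z with (RtoC (Re z) + Ci * RtoC (Im z)) at 1.
- eapply Rle_trans; [apply Cmod_triangle|].
  rewrite Cmod_mult, Cmod_Ci, !Cmod_R; lra.
- destruct z; unfold RtoC, Ci, Cplus, Cmult; simpl; f_equal; ring.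
Qed.

Lemma is_Cseries_pair (u : nat -> C) (a : C) :
  is_series (fun n => Re (u n)) (Re a) -> is_series (fun n => Im (u n)) (Im a) ->
  is_Cseries u a.
Proof.
intros H1 H2; apply is_Cseries_epsilon; intros eps He.
change (is_lim_seq (sum_n (fun n => Re (u n))) (Re a)) in H1.
change (is_lim_seq (sum_n (fun n => Im (u n))) (Im a)) in H2.
apply is_lim_seq_spec in H1; apply is_lim_seq_spec in H2.
destruct (H1 (mkposreal (eps / 2)%R ltac:(lra))) as [N1 HN1].
destruct (H2 (mkposreal (eps / 2)%R ltac:(lra))) as [N2 HN2].
cbn [pos] in HN1, HN2.
exists (N1 + N2)%nat; intros n Hn.
eapply Rle_lt_trans; [apply Cmod_le_Re_Im|].
assert (E1 := HN1 n ltac:(lia)); assert (E2 := HN2 n ltac:(lia)).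
rewrite <- Re_Csum in E1; rewrite <- Im_Csum in E2.
change (Re (Csum u n - a)) with (Re (Csum u n) - Re a)%R.
change (Im (Csum u n - a)) with (Im (Csum u n) - Im a)%R.
lra.
Qed.

Definition CPSeries (b : nat -> C) (t : R) : C :=
  (PSeries (fun n => Re (b n)) t, PSeries (fun n => Im (b n)) t).

Lemma Re_mult_R (z : C) (r : R) : Re (z * RtoC r) = (Re z * r)%R.
Proof. apply re_scal_r. Qed.

Lemma Im_mult_R (z : C) (r : R) : Im (z * RtoC r) = (Im z * r)%R.
Proof. apply im_scal_r. Qed.

Lemma Im_le_Cmod (z : C) : (Rabs (Im z) <= Cmod z)%R.
Proof. eapply Rle_trans; [apply Rmax_r|apply Rmax_Cmod]. Qed.

Lemma CV_radius_lt (b : nat -> R) (M r t : R) :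
  (Rabs t < r)%R -> (forall n, Rabs (b n) * r ^ n <= M)%R ->
  Rbar_lt (Rabs t) (CV_radius b).
Proof.
intros Ht H.
apply Rbar_lt_le_trans with r; [exact Ht|].
apply CV_radius_bounded; exists M; intros n.
assert (0 <= Rabs t)%R by apply Rabs_pos.
rewrite Rabs_mult, (Rabs_pos_eq (r ^ n)) by (apply pow_le; lra); apply H.
Qed.

Lemma CPSeries_correct (b : nat -> C) (M r t : R) :
  (Rabs t < r)%R -> (forall n, Cmod (b n) * r ^ n <= M)%R ->
  is_Cseries (fun n => b n * Cpow (RtoC t) n) (CPSeries b t) /\
  is_Cseries (fun n => CofNat (S n) * b (S n) * Cpow (RtoC t) n)
    (CPSeries (fun n => CofNat (S n) * b (S n)) t) /\
  is_Cderive (CPSeries b) t (CPSeries (fun n => CofNat (S n) * b (S n)) t).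
Proof.
intros Ht H.
assert (Hr : forall n, (0 <= r ^ n)%R)
  by (intros n; apply pow_le; assert (P := Rabs_pos t); lra).
assert (HR : Rbar_lt (Rabs t) (CV_radius (fun n => Re (b n)))).
{ apply CV_radius_lt with M r; [exact Ht|]; intros n.
  eapply Rle_trans; [|apply H]; apply Rmult_le_compat_r; [apply Hr|].
  apply re_le_Cmod. }
assert (HI : Rbar_lt (Rabs t) (CV_radius (fun n => Im (b n)))).
{ apply CV_radius_lt with M r; [exact Ht|]; intros n.
  eapply Rle_trans; [|apply H]; apply Rmult_le_compat_r; [apply Hr|].
  apply Im_le_Cmod. }
assert (ER : PS_derive (fun n => Re (b n))
             = fun n => Re (CofNat (S n) * b (S n))).
{ apply functional_extensionality; intros n; unfold PS_derive, CofNat.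
  now rewrite re_scal_l. }
assert (EI : PS_derive (fun n => Im (b n))
             = fun n => Im (CofNat (S n) * b (S n))).
{ apply functional_extensionality; intros n; unfold PS_derive, CofNat.
  now rewrite im_scal_l. }
assert (HP : forall (c : nat -> C),
  Rbar_lt (Rabs t) (CV_radius (fun n => Re (c n))) ->
  Rbar_lt (Rabs t) (CV_radius (fun n => Im (c n))) ->
  is_Cseries (fun n => c n * Cpow (RtoC t) n) (CPSeries c t)).
{ intros c H1 H2; apply is_Cseries_pair.
  - apply is_series_ext with (fun n => Re (c n) * t ^ n)%R.
    + intros n; now rewrite <- RtoC_pow, Re_mult_R.
    + apply Series_correct, ex_series_Rabs, CV_disk_inside, H1.
  - apply is_series_ext with (fun n => Im (c n) * t ^ n)%R.
    + intros n; now rewrite <- RtoC_pow, Im_mult_R.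
    + apply Series_correct, ex_series_Rabs, CV_disk_inside, H2. }
split; [|split].
- apply HP; assumption.
- apply (HP (fun n => CofNat (S n) * b (S n))).
  + rewrite <- ER, CV_radius_derive; exact HR.
  + rewrite <- EI, CV_radius_derive; exact HI.
- split.
  + unfold CPSeries, Re at 3; cbn [fst]; rewrite <- ER.
    apply (is_derive_PSeries (fun n => Re (b n))), HR.
  + unfold CPSeries, Im at 3; cbn [snd]; rewrite <- EI.
    apply (is_derive_PSeries (fun n => Im (b n))), HI.
Qed.

Lemma CPSeries_0 (b : nat -> C) : CPSeries b 0 = b O.
Proof.
unfold CPSeries; rewrite !PSeries_0; now destruct (b O).
Qed.

Lemma is_Cderive_0_const (f : R -> C) (a b : R) :
  (a < b)%R -> (forall t, a <= t <= b -> is_Cderive f t 0)%R -> f a = f b.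
Proof.
intros Hab H.
assert (E1 : Re (f a) = Re (f b)).
{ apply (eq_is_derive (fun t => Re (f t))); [|exact Hab].
  intros t Ht; apply (H t Ht). }
assert (E2 : Im (f a) = Im (f b)).
{ apply (eq_is_derive (fun t => Im (f t))); [|exact Hab].
  intros t Ht; apply (H t Ht). }
destruct (f a), (f b); simpl in *; congruence.
Qed.

Lemma Re_ge_opp_Cmod (z : C) : (- Cmod z <= Re z)%R.
Proof.
assert (H := re_le_Cmod z); assert (P := Rle_abs (- Re z)).
rewrite Rabs_Ropp in P; lra.
Qed.

(* Along the ray t u, the product of the series with (1 + t u)^(-c) has zero
   derivative. *)
Lemma binomial_series (c u : C) :
  (Cmod u < 1 / 2)%R ->
  is_Cseries (fun n => binom c n * Cpow u n) (Cpower (1 + u) c).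
Proof.
intros Hu.
set (b := fun n => binom c n * Cpow u n).
destruct (nfloor_ex (Cmod c) (Cmod_ge_0 c)) as [m0 [_ Hm]].
assert (Hm' : (Cmod c <= INR (S m0))%R) by (rewrite S_INR; lra).
set (m := S m0) in *; clearbody m; clear m0 Hm.
assert (Pu := Cmod_ge_0 u).
(* A radius above 1 with [2 |u| r <= 1]: the series in [t] must be differentiable up to and
   including [t = 1], while [b n * r ^ n] has to stay bounded. *)
set (r := (2 / (1 + 2 * Cmod u))%R).
assert (Hr1 : (1 < r)%R).
{ unfold r; apply Rmult_lt_reg_r with (1 + 2 * Cmod u)%R; [lra|].
  unfold Rdiv; rewrite Rmult_assoc, Rinv_l; lra. }
assert (Hr2 : (2 * Cmod u * r <= 1)%R).
{ unfold r; apply Rmult_le_reg_r with (1 + 2 * Cmod u)%R; [lra|].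
  unfold Rdiv; rewrite !Rmult_assoc, Rinv_l; nra. }
assert (Hb : forall n, (Cmod (b n) * r ^ n <= 2 ^ m)%R).
{ intros n; unfold b; rewrite Cmod_mult, Cmod_pow.
  assert (H1 := Cmod_binom_le c m n Hm'); rewrite pow_add in H1.
  assert (H2 : (0 <= Cmod u ^ n * r ^ n)%R)
    by (apply Rmult_le_pos; apply pow_le; lra).
  assert (H3 : (0 < 2 ^ m)%R) by (apply pow_lt; lra).
  apply Rle_trans with ((2 ^ m * 2 ^ n) * (Cmod u ^ n * r ^ n))%R.
  { rewrite Rmult_assoc; apply Rmult_le_compat_r; assumption. }
  replace (2 ^ m * 2 ^ n * (Cmod u ^ n * r ^ n))%R
    with (2 ^ m * (2 * Cmod u * r) ^ n)%R by (rewrite !Rpow_mult_distr; ring).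
  rewrite <- (Rmult_1_r (2 ^ m)) at 2; apply Rmult_le_compat_l; [lra|].
  rewrite <- (pow1 n); apply pow_incr; nra. }
assert (Ht : forall t, (0 <= t <= 1)%R -> (Rabs t < r)%R)
  by (intros t Ht; rewrite Rabs_pos_eq; lra).
(* The differential equation [(1 + t u) P' = c u P], which is [binom_S] read coefficientwise. *)
assert (Hode : forall t, (0 <= t <= 1)%R ->
  (1 + RtoC t * u) * CPSeries (fun n => CofNat (S n) * b (S n)) t
  = c * u * CPSeries b t).
{ intros t Htt.
  destruct (CPSeries_correct b (2 ^ m) r t (Ht t Htt) Hb) as [S1 [S2 _]].
  apply (is_Cseries_unique (fun n => c * u * (b n * Cpow (RtoC t) n)));
    [|now apply is_Cseries_scal].
  assert (S3 := is_Cseries_scal (RtoC t * u) _ _ (is_Cseries_shift _ _ S2)).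
  assert (S4 := is_Cseries_plus _ _ _ _ S2 S3).
  rewrite Cmult_plus_distr_r, Cmult_1_l.
  eapply is_Cseries_ext; [|exact S4]; intros n; cbv beta.
  assert (B : CofNat (S n) * b (S n) = (c - CofNat n) * u * b n).
  { unfold b; rewrite CofNat_S, Cmult_assoc, binom_S, Cpow_S; ring. }
  rewrite B; destruct n as [|n]; simpl shift_seq.
  - rewrite CofNat_0; ring.
  - rewrite Cpow_S; ring. }
assert (Hpos : forall t, (0 <= t <= 1)%R -> (0 < 1 + t * Re u)%R).
{ intros t Htt; assert (H := Re_ge_opp_Cmod u).
  assert (t * Re u >= - (1 / 2))%R by nra; lra. }
set (Q := fun t => CPSeries b t * Cexp (- c * Clog (1 + RtoC t * u))).
assert (HQ : Q 0%R = Q 1%R).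
{ apply is_Cderive_0_const; [lra|]; intros t Htt.
  destruct (CPSeries_correct b (2 ^ m) r t (Ht t Htt) Hb) as [_ [_ S3]].
  assert (L1 := is_Cderive_mult _ _ _ _ _ (is_Cderive_const (- c) t)
                 (is_Cderive_log u t (Hpos t Htt))).
  assert (L2 := is_Cderive_mult _ _ _ _ _ S3 (is_Cderive_exp _ _ _ L1)).
  unfold Q; eapply eq_rect; [exact L2|].
  assert (N : 1 + RtoC t * u <> 0).
  { apply Re_pos_neq_0; simpl; unfold Re in Hpos; 
    specialize (Hpos t Htt); simpl in Hpos; lra. }
  replace (CPSeries (fun n => CofNat (S n) * b (S n)) t)
    with (c * u * CPSeries b t / (1 + RtoC t * u)).
  - field; exact N.
  - rewrite <- Hode by exact Htt; field; exact N. }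
destruct (CPSeries_correct b (2 ^ m) r 1 (Ht 1%R ltac:(lra)) Hb) as [S1 _].
replace (Cpower (1 + u) c) with (CPSeries b 1).
- eapply is_Cseries_ext; [|exact S1]; intros n; cbv beta.
  rewrite Cpow_1_l, Cmult_1_r; reflexivity.
- unfold Q in HQ; rewrite CPSeries_0 in HQ.
  replace (1 + RtoC 0 * u) with (RtoC 1) in HQ by ring.
  replace (1 + RtoC 1 * u) with (1 + u) in HQ by ring.
  assert (L0 : Clog 1 = 0).
  { unfold Clog, Carg; rewrite Cmod_1, ln_1; simpl.
    unfold Rdiv; rewrite Rmult_0_l, atan_0, Rmult_0_r; reflexivity. }
  rewrite L0, Cmult_0_r, Cexp_0 in HQ.
  unfold Cpower; apply (Cmult_cancel_r (Cexp (- c * Clog (1 + u))));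
    [apply Cexp_neq_0|].
  rewrite <- HQ, <- Cexp_plus.
  replace (c * Clog (1 + u) + - c * Clog (1 + u)) with (RtoC 0) by ring.
  rewrite Cexp_0; unfold b, binom; simpl.
  change (CofNat 1) with (RtoC 1); field.
Qed.

(** * The generating function identity *)

Lemma near_1 (y : C) : (Cmod (y - 1) < 1 / 2)%R ->
  (1 / 2 < Re y)%R /\ y <> 0 /\ (1 / 2 < Cmod y)%R.
Proof.
intros H.
assert (H1 := Re_ge_opp_Cmod (y - 1)).
change (Re (y - 1)) with (Re y - 1)%R in H1.
assert (H2 : (1 / 2 < Re y)%R) by lra.
split; [exact H2|split; [apply Re_pos_neq_0; lra|]].
eapply Rlt_le_trans; [exact H2|].
eapply Rle_trans; [apply Rle_abs|apply re_le_Cmod].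
Qed.

Lemma Cpower_opp_mult (y c : C) : Cpower y (- c) * Cpower y c = 1.
Proof.
unfold Cpower; rewrite <- Cexp_plus.
replace (- c * Clog y + c * Clog y) with (RtoC 0) by ring.
apply Cexp_0.
Qed.

(* Unlike [fhat_sum], this expression of the coefficients in terms of
   [w k = binom (A + B k) k * f k] has no poles in [A] beyond those of [w]. *)
Definition transform (A B : C) (w : nat -> C) (r : nat) : C :=
  Csum (fun k => Cpow (-1) k * binom (A + B * CofNat k - CofNat k) (r - k) * w k) r.

Lemma ex_nat_ge_Cmod (c : C) : exists m : nat, (Cmod c <= INR m)%R.
Proof.
destruct (nfloor_ex (Cmod c) (Cmod_ge_0 c)) as [m [_ H]].
exists (S m); rewrite S_INR; lra.
Qed.

(* With [u = (1 - y) / y], so that [1 + u = 1 / y], expand each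
   [(1 + u) ^ (A + B k - k)] by the binomial series and sum along antidiagonals. *)
Lemma transform_series (A B : C) (w : nat -> C) :
  geom_dominated w ->
  exists rho : R, (0 < rho)%R /\ forall y : C, (Cmod (y - 1) < rho)%R ->
    exists S : C,
      is_Cseries (fun k => w k * Cpow ((y - 1) * Cpower y (- B)) k) S /\
      is_Cseries (fun r => transform A B w r * Cpow ((1 - y) / y) r)
        (Cpower y (- A) * S).
Proof.
intros [M [K [HM [HK Hw]]]].
destruct (ex_nat_ge_Cmod A) as [m0 H0].
destruct (ex_nat_ge_Cmod (B - 1)) as [m1 H1].
set (K' := (K * 2 ^ m1)%R).
assert (HK' : (0 <= K')%R) by (apply Rmult_le_pos; [lra|apply pow_le; lra]).
(* Chosen so that [|u| <= 2 |y - 1|] makes both [K' |u|] and [2 |u|] at most 1/2; these are the two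
   ratios of the double series. [K'] includes the factor [2^m1] by which the binomial bound grows
   with each step of [k]. *)
exists (/ (8 * (K' + 1)))%R; split; [apply Rinv_0_lt_compat; lra|].
intros y Hy.
assert (Hrho : (/ (8 * (K' + 1)) <= / 8)%R) by (apply Rinv_le_contravar; lra).
assert (Hrho' : ((K' + 1) * / (8 * (K' + 1)) = / 8)%R) by (field; lra).
destruct (near_1 y ltac:(lra)) as [Hre [Hy0 Hmy]].
set (u := (1 - y) / y).
assert (Hu : (Cmod u <= 2 * Cmod (y - 1))%R).
{ unfold u; rewrite Cmod_div by exact Hy0.
  replace (1 - y) with (- (y - 1)) by ring; rewrite Cmod_opp.
  apply Rmult_le_reg_r with (Cmod y); [lra|].
  unfold Rdiv; rewrite Rmult_assoc, Rinv_l by lra.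
  assert (P := Cmod_ge_0 (y - 1)); nra. }
assert (Pu := Cmod_ge_0 u).
assert (Hu1 : (K' * Cmod u <= 1 / 2)%R).
{ assert ((K' + 1) * Cmod (y - 1) <= / 8)%R.
  { rewrite <- Hrho'; apply Rmult_le_compat_l; lra. }
  assert (P := Cmod_ge_0 (y - 1)); nra. }
assert (Hu2 : (2 * Cmod u <= 1 / 2)%R) by lra.
set (N := fun k => A + B * CofNat k - CofNat k).
set (t := fun k j => Cpow (- u) k * w k * (binom (N k) j * Cpow u j)).
set (R0 := fun k => Cpow (- u) k * w k * Cpower (1 + u) (N k)).
set (D := (M * 2 ^ m0)%R).
assert (HD : (0 <= D)%R) by (apply Rmult_le_pos; [lra|apply pow_le; lra]).
assert (Ht : forall k j, (Cmod (t k j) <= D * (1 / 2) ^ (k + j))%R).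
{ intros k j; unfold t.
  rewrite !Cmod_mult, !Cmod_pow, Cmod_opp.
  assert (HN : (Cmod (N k) <= INR (m0 + m1 * k))%R).
  { unfold N; replace (A + B * CofNat k - CofNat k) with (A + (B - 1) * CofNat k)
      by ring.
    eapply Rle_trans; [apply Cmod_triangle|].
    rewrite Cmod_mult, Cmod_CofNat, plus_INR, mult_INR.
    apply Rplus_le_compat; [exact H0|].
    apply Rmult_le_compat_r; [apply pos_INR|exact H1]. }
  assert (HB := Cmod_binom_le _ _ j HN).
  assert (P1 : (0 <= Cmod u ^ k)%R) by (apply pow_le; lra).
  assert (P2 : (0 <= Cmod u ^ j)%R) by (apply pow_le; lra).
  apply Rle_trans with
    (Cmod u ^ k * (M * K ^ k) * (2 ^ (m0 + m1 * k + j) * Cmod u ^ j))%R.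
  { apply Rmult_le_compat.
    - apply Rmult_le_pos; [exact P1|apply Cmod_ge_0].
    - apply Rmult_le_pos; [apply Cmod_ge_0|exact P2].
    - apply Rmult_le_compat_l; [exact P1|apply Hw].
    - apply Rmult_le_compat_r; [exact P2|exact HB]. }
  replace (Cmod u ^ k * (M * K ^ k) * (2 ^ (m0 + m1 * k + j) * Cmod u ^ j))%R
    with (D * ((K' * Cmod u) ^ k * (2 * Cmod u) ^ j))%R.
  2:{ unfold D, K'; rewrite !Rpow_mult_distr, !pow_add, <- pow_mult; ring. }
  apply Rmult_le_compat_l; [exact HD|]; rewrite pow_add.
  apply Rmult_le_compat; try (apply pow_le; nra); apply pow_incr; nra. }
assert (HR : forall k, is_Cseries (t k) (R0 k)).
{ intros k; unfold t, R0; apply is_Cseries_scal, binomial_series; lra. }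
assert (HRb : forall k, (Cmod (R0 k) <= 4 * D * (1 / 2) ^ k)%R).
{ intros k.
  replace (4 * D * (1 / 2) ^ k)%R with (2 * (D * (1 / 2) ^ k) / (1 - 1 / 2))%R
    by field.
  apply (Cseries_bound_geom (t k)); [|lra| |apply HR].
  - apply Rmult_le_pos; [exact HD|apply pow_le; lra].
  - intros n; rewrite Rmult_assoc, <- pow_add; apply Ht. }
destruct (ex_Cseries_geom R0 _ (1 / 2) ltac:(lra) HRb) as [L HL].
(* Row [k] sums to [y^(-A) w_k x^k], so undoing the common factor [y^(-A)] gives the sum of
   [w_k x^k]. *)
exists (Cpower y A * L); split.
- apply (is_Cseries_scal (Cpower y A)) in HL.
  eapply is_Cseries_ext; [|exact HL]; intros k; cbv beta; unfold R0.
  replace (1 + u) with (/ y) by (unfold u; field; exact Hy0).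
  replace (- u) with ((y - 1) * Cexp (- Clog y)).
  2:{ rewrite Cexp_opp, Cexp_Clog by lra; unfold u; field; exact Hy0. }
  unfold Cpower; rewrite Clog_inv, !Cpow_mult_l, !Cexp_pow by lra.
  transitivity (w k * Cpow (y - 1) k * (Cexp (A * Clog y)
    * (Cexp (CofNat k * - Clog y) * Cexp (N k * - Clog y)))); [ring|].
  rewrite <- !Cexp_plus, <- Cmult_assoc; do 3 f_equal; unfold N; ring.
- rewrite Cmult_assoc, Cpower_opp_mult, Cmult_1_l.
  eapply is_Cseries_ext;
    [|exact (is_Cseries_antidiagonal t R0 L D (1 / 2) HD ltac:(lra) Ht HR HL)].
  intros r; cbv beta; unfold transform.
  rewrite Cmult_comm, <- Csum_scal; apply Csum_ext; intros k Hk; unfold t; fold u.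
  replace (- u) with ((-1) * u) by ring.
  rewrite Cpow_mult_l.
  replace r with (k + (r - k))%nat at 3 by lia.
  rewrite Cpow_add_r; fold (N k); ring.
Qed.

(** * Finite differences *)

Lemma CofNat_plus_1_neq_0 (n : nat) : CofNat n + 1 <> 0.
Proof. rewrite <- CofNat_S; apply CofNat_neq_0. Qed.

Lemma poch_0_S (n : nat) : poch 0 (S n) = 0.
Proof. rewrite poch_S_l; ring. Qed.

Lemma binom_0 (c : C) : binom c 0 = 1.
Proof. unfold binom; simpl; change (CofNat 1) with (RtoC 1); field. Qed.

Lemma binom_nat_lt (n : nat) : binom (CofNat n) (S n) = 0.
Proof.
unfold binom; rewrite CofNat_S.
replace (CofNat n - (CofNat n + 1) + 1) with (RtoC 0) by ring.
rewrite poch_0_S; unfold Cdiv; ring.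
Qed.

Lemma binom_absorb_l (c : C) (k : nat) :
  (c + 1 - CofNat k) * binom (c + 1) k = (c + 1) * binom c k.
Proof.
unfold binom.
replace (c + 1 - CofNat k + 1) with ((c - CofNat k + 1) + 1) by ring.
assert (H := poch_S_l (c - CofNat k + 1) k); rewrite poch_S in H.
replace (c - CofNat k + 1 + CofNat k) with (c + 1) in H by ring.
replace (c + 1 - CofNat k) with (c - CofNat k + 1) by ring.
unfold Cdiv; rewrite !Cmult_assoc, <- H; ring.
Qed.

Lemma alternating_binom_sum (c : C) (n : nat) :
  Csum (fun k => Cpow (-1) k * binom (c + 1) k) n = Cpow (-1) n * binom c n.
Proof.
induction n as [|n IH]; [rewrite Csum_O, !binom_0; reflexivity|].
rewrite Csum_S, IH.
apply (Cmult_cancel_r (CofNat n + 1)); [apply CofNat_plus_1_neq_0|].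
rewrite !Cpow_S.
transitivity ((-1) ^ n * ((CofNat n + 1) * binom c n
                          - (CofNat n + 1) * binom (c + 1) (S n))); [ring|].
rewrite binom_S, binom_absorb_l.
transitivity (- (-1) ^ n * ((CofNat n + 1) * binom c (S n))); [|ring].
rewrite binom_S; ring.
Qed.

(** Up to the sign [(-1)^n], the [n]-th forward difference of [q] at 0. *)
Definition Cdiff (q : nat -> C) (n : nat) : C :=
  Csum (fun k => Cpow (-1) k * binom (CofNat n) k * q k) n.

Lemma Cdiff_S (q : nat -> C) (n : nat) :
  Csum (fun k => Cpow (-1) k * ((CofNat (S n) - CofNat k) * binom (CofNat (S n)) k)
                 * q k) (S n)
  = CofNat (S n) * Cdiff q n.
Proof.
unfold Cdiff; rewrite <- Csum_scal, Csum_S.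
replace (CofNat (S n) - CofNat (S n)) with (RtoC 0) by ring.
rewrite !Cmult_0_l, Cmult_0_r, Cmult_0_l, Cplus_0_r.
apply Csum_ext; intros k _; rewrite CofNat_S, binom_absorb_l; ring.
Qed.

(** Leibniz rule for a linear factor: write [al + be k = (al + be (n + 1)) - be (n + 1 - k)] and
    absorb [n + 1 - k] into the binomial coefficient. *)
Lemma Cdiff_linear (al be : C) (q : nat -> C) (n : nat) :
  Cdiff (fun k => (al + be * CofNat k) * q k) (S n)
  = (al + be * CofNat (S n)) * Cdiff q (S n) - be * (CofNat (S n) * Cdiff q n).
Proof.
rewrite <- Cdiff_S; unfold Cdiff.
match goal with |- _ = ?x - be * ?y =>
  replace (x - be * y) with (x + (- be) * y) by ring end.
rewrite <- !Csum_scal, <- Csum_plus; apply Csum_ext; intros k _; ring.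
Qed.

(** The symbol is a polynomial in [k] of degree at most [m] with coefficient [be^m] at [k^m]; the
    difference of order [n] kills degrees below [n] and sends [k^n] to [n!], up to sign. *)
Lemma Cdiff_poch (al be : C) (m n : nat) :
  (m <= n)%nat ->
  Cdiff (fun k => poch (al + be * CofNat k) m) n
  = if (m =? n)%nat then Cpow (- be) n * CofNat (fact n) else 0.
Proof.
revert n; induction m as [|m IH]; intros n Hmn.
- unfold Cdiff; destruct n as [|n].
  + rewrite Csum_O, binom_0; simpl; change (CofNat 1) with (RtoC 1); ring.
  + simpl; rewrite (Csum_ext _ (fun k => Cpow (-1) k * binom (CofNat n + 1) k))
      by (intros; rewrite CofNat_S; ring).
    rewrite alternating_binom_sum, binom_nat_lt; ring.
- destruct n as [|n]; [lia|].
  transitivity (Cdiff (fun k => (al + CofNat m + be * CofNat k)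
                                * poch (al + be * CofNat k) m) (S n)).
  { unfold Cdiff; apply Csum_ext; intros k _; rewrite poch_S; ring. }
  rewrite Cdiff_linear, !IH by lia.
  replace (m =? S n)%nat with false by (symmetry; apply Nat.eqb_neq; lia).
  simpl (S m =? S n)%nat; destruct (m =? n)%nat.
  + rewrite Cpow_S, CofNat_fact_S, CofNat_S; ring.
  + ring.
Qed.

(** The numbers [h_r], with the weights left arbitrary so that one recurrence serves both [F] and
    [G]. *)
Definition binom_diff (A B : C) (f : nat -> C) (r : nat) : C :=
  Cdiff (fun k => binom (A + B * CofNat k) r * f k) r.

Lemma binom_diff_ext (A B : C) (f g : nat -> C) (r : nat) :
  (forall k, (k <= r)%nat -> f k = g k) -> binom_diff A B f r = binom_diff A B g r.
Proof.
intros H; unfold binom_diff, Cdiff; apply Csum_ext; intros k Hk; now rewrite H.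
Qed.

Lemma binom_diff_plus (A B a b : C) (f g : nat -> C) (r : nat) :
  binom_diff A B (fun k => a * f k + b * g k) r
  = a * binom_diff A B f r + b * binom_diff A B g r.
Proof.
unfold binom_diff, Cdiff; rewrite <- !Csum_scal, <- Csum_plus.
apply Csum_ext; intros; ring.
Qed.

(** [binom (A + B k) r] has coefficient [B^r / r!] at [k^r]. The generating function is therefore
    [1 / (1 + B u)], which is [F_1]. *)
Lemma binom_diff_1 (A B : C) (r : nat) :
  binom_diff A B (fun _ => 1) r = Cpow (- B) r.
Proof.
assert (H := Cdiff_poch (A - CofNat r + 1) B r r (le_n r)).
rewrite Nat.eqb_refl in H.
apply (Cmult_cancel_r (CofNat (fact r))); [apply fact_neq_0_C|].
rewrite <- H; unfold binom_diff, Cdiff; rewrite Cmult_comm, <- Csum_scal.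
apply Csum_ext; intros k _; unfold binom.
replace (A + B * CofNat k - CofNat r + 1) with (A - CofNat r + 1 + B * CofNat k)
  by ring.
field; split; apply fact_neq_0_C.
Qed.

(** Evaluate the sum of [(-1)^k (n + 1 - k) binom(n + 1, k) binom(A + B k, n + 1) f(k)] twice: by
    splitting [n + 1 - k], and by absorbing it and then lowering [binom(A + B k, n + 1)] to order
    [n]. The result trades a factor [k] in the weights for a factor of the index. *)
Lemma binom_diff_rec (A B : C) (f : nat -> C) (n : nat) :
  binom_diff A B (fun k => CofNat k * f k) (S n)
    + B * binom_diff A B (fun k => CofNat k * f k) n
  = CofNat (S n) * binom_diff A B f (S n) + (CofNat n - A) * binom_diff A B f n.
Proof.
assert (H := Cdiff_S (fun k => binom (A + B * CofNat k) (S n) * f k) n).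
assert (H1 : CofNat (S n) * Cdiff (fun k => binom (A + B * CofNat k) (S n) * f k) n
  = (A - CofNat n) * binom_diff A B f n
    + B * binom_diff A B (fun k => CofNat k * f k) n).
{ unfold binom_diff, Cdiff; rewrite <- !Csum_scal, <- Csum_plus.
  apply Csum_ext; intros k _; rewrite CofNat_S.
  transitivity (Cpow (-1) k * binom (CofNat n) k
    * ((CofNat n + 1) * binom (A + B * CofNat k) (S n)) * f k); [ring|].
  rewrite binom_S; ring. }
assert (H2 : Csum (fun k => Cpow (-1) k
    * ((CofNat (S n) - CofNat k) * binom (CofNat (S n)) k)
    * (binom (A + B * CofNat k) (S n) * f k)) (S n)
  = CofNat (S n) * binom_diff A B f (S n)
    + (-1) * binom_diff A B (fun k => CofNat k * f k) (S n)).
{ unfold binom_diff, Cdiff; rewrite <- !Csum_scal, <- Csum_plus.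
  apply Csum_ext; intros k _; ring. }
rewrite H1, H2 in H.
transitivity (CofNat (S n) * binom_diff A B f (S n)
  - (CofNat (S n) * binom_diff A B f (S n)
    + (-1) * binom_diff A B (fun k => CofNat k * f k) (S n))
  + B * binom_diff A B (fun k => CofNat k * f k) n); [ring|].
rewrite H; ring.
Qed.

Lemma poch_nat (j k : nat) :
  CofNat (fact (j + k)) = CofNat (fact j) * poch (CofNat j + 1) k.
Proof.
induction k as [|k IH]; [rewrite Nat.add_0_r; simpl; ring|].
rewrite Nat.add_succ_r, CofNat_fact_S, IH, poch_S, CofNat_plus; ring.
Qed.

Lemma binom_mult_binom (N : C) (k j : nat) :
  binom (CofNat (k + j)) k * binom N (k + j) = binom N k * binom (N - CofNat k) j.
Proof.
unfold binom; rewrite CofNat_plus.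
replace (CofNat k + CofNat j - CofNat k + 1) with (CofNat j + 1) by ring.
replace (k + j)%nat with (j + k)%nat by lia.
rewrite poch_nat, (poch_add _ j k).
replace (N - (CofNat k + CofNat j) + 1) with (N - CofNat k - CofNat j + 1) by ring.
replace (N - CofNat k - CofNat j + 1 + CofNat j) with (N - CofNat k + 1) by ring.
assert (poch (CofNat j + 1) k <> 0).
{ intros H; apply (fact_neq_0_C (j + k)); rewrite poch_nat, H; ring. }
field; repeat split; auto using fact_neq_0_C.
Qed.

(** Trinomial revision [binom(r, k) binom(N, r) = binom(N, k) binom(N - k, r - k)] with
    [N = A + B k]. *)
Lemma transform_binom (A B : C) (f : nat -> C) (r : nat) :
  transform A B (fun k => binom (A + B * CofNat k) k * f k) r = binom_diff A B f r.
Proof.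
unfold transform, binom_diff, Cdiff; apply Csum_ext; intros k Hk.
assert (H := binom_mult_binom (A + B * CofNat k) k (r - k)).
replace (k + (r - k))%nat with r in H by lia.
transitivity (Cpow (-1) k * (binom (A + B * CofNat k) k
   * binom (A + B * CofNat k - CofNat k) (r - k)) * f k); [ring|].
rewrite <- H; ring.
Qed.

Lemma fhat_sum_binom_diff (l : Z) (A B : C) (r : nat) :
  fhat_sum l A B r = binom_diff A B (fl l A B) r.
Proof.
unfold fhat_sum, binom_diff, Cdiff; apply Csum_ext; intros k _; ring.
Qed.

(** * Closed form of the series coefficients at B = 1/2 *)

Lemma poch_opp (c : C) (j : nat) :
  poch (- c) j = Cpow (-1) j * poch (c - CofNat j + 1) j.
Proof.
induction j as [|j IH]; [simpl; ring|].
rewrite poch_S, IH, poch_S_l, Cpow_S, CofNat_S.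
replace (c - (CofNat j + 1) + 1 + 1) with (c - CofNat j + 1) by ring; ring.
Qed.

Lemma pochZ_nonneg (c : C) (n : nat) : pochZ c (Z.of_nat n) = poch c n.
Proof.
unfold pochZ; replace (0 <=? Z.of_nat n)%Z with true
  by (symmetry; apply Z.leb_le; lia).
now rewrite Nat2Z.id.
Qed.

Lemma CofZ_of_nat (n : nat) : CofZ (Z.of_nat n) = CofNat n.
Proof. unfold CofZ, CofNat; now rewrite <- INR_IZR_INZ. Qed.

Lemma CofZ_opp (z : Z) : CofZ (- z) = - CofZ z.
Proof. unfold CofZ; now rewrite opp_IZR, RtoC_opp. Qed.

Lemma pochZ_nonpos (c : C) (n : nat) :
  pochZ c (- Z.of_nat n) = / poch (c - CofNat n) n.
Proof.
destruct n as [|n].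
- unfold pochZ; simpl; field.
- unfold pochZ; replace (0 <=? - Z.of_nat (S n))%Z with false
    by (symmetry; apply Z.leb_gt; lia).
  rewrite Z.opp_involutive, Nat2Z.id, CofZ_opp, CofZ_of_nat; reflexivity.
Qed.

(* [binom (A + k / 2) k * fl l A (1 / 2) k], with [e = A + l] and
   [cst = odd_const l A], in a form that stays regular where [fl] has removable
   poles in [A]. *)
Definition series_coef (A e cst : C) (k : nat) : C :=
  let j := Nat.div2 k in
  Cpow (-1) j
  * (if Nat.even k then poch (- A) j * poch e j
     else cst * (poch (- A + 1 / 2) j * poch (e + 1 / 2) j))
  / CofNat (fact k).

Lemma series_coef_even (A e cst : C) (j : nat) :
  series_coef A e cst (2 * j)
  = Cpow (-1) j * (poch (- A) j * poch e j) / CofNat (fact (2 * j)).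
Proof.
unfold series_coef; rewrite Nat.even_even, Nat.div2_double; reflexivity.
Qed.

Lemma series_coef_odd (A e cst : C) (j : nat) :
  series_coef A e cst (S (2 * j))
  = Cpow (-1) j * (cst * (poch (- A + 1 / 2) j * poch (e + 1 / 2) j))
    / CofNat (fact (S (2 * j))).
Proof.
unfold series_coef; rewrite Nat.div2_succ_double.
replace (Nat.even (S (2 * j))) with false; [reflexivity|].
symmetry; rewrite Nat.even_succ, <- Nat.negb_even, Nat.even_even; reflexivity.
Qed.

Lemma even_or_odd (k : nat) : exists j, k = (2 * j)%nat \/ k = S (2 * j).
Proof.
destruct (Nat.Even_or_Odd k) as [[j H]|[j H]]; exists j; [left|right]; lia.
Qed.

(** The coefficient [w_1 = binom(A + 1/2, 1) f_l(1)]; it is a common factor of all odd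
    coefficients. *)
Definition odd_const (l : Z) (A : C) : C :=
  pochZ (A + 1 / 2) l / pochZ (A + 1) (l - 1).

Lemma Cpow_m1_sq (j : nat) : Cpow (-1) j * Cpow (-1) j = 1.
Proof.
rewrite <- Cpow_mult_l; replace ((-1) * (-1)) with (RtoC 1) by ring.
apply Cpow_1_l.
Qed.

Lemma poch_opp_reflect (c : C) (j : nat) :
  Cpow (-1) j * poch (- c) j = poch (c - CofNat j + 1) j.
Proof. rewrite poch_opp, Cmult_assoc, Cpow_m1_sq; ring. Qed.

Lemma CofNat_double (j : nat) : CofNat (2 * j) = 2 * CofNat j.
Proof. rewrite CofNat_mult; reflexivity. Qed.

(** For [k = 2 j] the shift [k / 2] is an integer and [binom] contributes [(A - j + 1)_j (A + 1)_j];
    splitting [(A + 1)_(j + d)] in two ways moves the dependence of [fl] on [j] into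
    [(A + 1 + d)_j]. Odd [k] is the same with [(A + 1/2)_(j + 1 + d)]. *)
Lemma binom_fl_pos (A : C) (d k : nat) :
  poch (A + 1) d <> 0 ->
  binom (A + 1 / 2 * CofNat k) k * fl (Z.of_nat (S d)) A (1 / 2) k
  = series_coef A (A + CofNat (S d)) (odd_const (Z.of_nat (S d)) A) k.
Proof.
intros H; unfold fl, odd_const.
rewrite pochZ_nonneg.
replace (Z.of_nat (S d) - 1)%Z with (Z.of_nat d) by lia.
rewrite !pochZ_nonneg.
destruct (even_or_odd k) as [j [-> | ->]].
- rewrite series_coef_even; unfold binom; rewrite CofNat_double, CofNat_S.
  rewrite (Cmult_assoc (Cpow (-1) j)), poch_opp_reflect.
  replace (A + 1 / 2 * (2 * CofNat j) - 2 * CofNat j + 1)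
    with (A - CofNat j + 1) by field.
  replace (A + 1 / 2 * (2 * CofNat j) + 1) with (A + CofNat j + 1) by field.
  assert (E1 := poch_add (A - CofNat j + 1) j j).
  replace (j + j)%nat with (2 * j)%nat in E1 by lia.
  replace (A - CofNat j + 1 + CofNat j) with (A + 1) in E1 by ring.
  assert (E2 := poch_add (A + 1) j d).
  replace (A + 1 + CofNat j) with (A + CofNat j + 1) in E2 by ring.
  assert (E3 := poch_add (A + 1) d j).
  replace (d + j)%nat with (j + d)%nat in E3 by lia.
  rewrite E2 in E3.
  replace (A + 1 + CofNat d) with (A + (CofNat d + 1)) in E3 by ring.
  rewrite E1.
  transitivity (poch (A - CofNat j + 1) j
    * (poch (A + 1) j * poch (A + CofNat j + 1) d) / poch (A + 1) d
    / CofNat (fact (2 * j))).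
  { field; split; auto using fact_neq_0_C. }
  rewrite E3; field; split; auto using fact_neq_0_C.
- rewrite series_coef_odd; unfold binom; rewrite !CofNat_S, CofNat_double.
  replace (- A + 1 / 2) with (- (A - 1 / 2)) by ring.
  replace (Cpow (-1) j * (poch (A + 1 / 2) (S d) / poch (A + 1) d
    * (poch (- (A - 1 / 2)) j * poch (A + (CofNat d + 1) + 1 / 2) j)))
  with (poch (A + 1 / 2) (S d) / poch (A + 1) d
    * ((Cpow (-1) j * poch (- (A - 1 / 2)) j) * poch (A + (CofNat d + 1) + 1 / 2) j))
    by ring.
  rewrite poch_opp_reflect.
  replace (A + 1 / 2 * (2 * CofNat j + 1) - (2 * CofNat j + 1) + 1)
    with (A - 1 / 2 - CofNat j + 1) by field.
  replace (A + 1 / 2 * (2 * CofNat j + 1) + 1)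
    with (A + 1 / 2 + CofNat (S j)) by (rewrite CofNat_S; field).
  assert (E1 := poch_add (A - 1 / 2 - CofNat j + 1) j (S j)).
  replace (j + S j)%nat with (S (2 * j)) in E1 by lia.
  replace (A - 1 / 2 - CofNat j + 1 + CofNat j) with (A + 1 / 2) in E1 by field.
  assert (E2 := poch_add (A + 1 / 2) (S j) d).
  assert (E3 := poch_add (A + 1 / 2) (S d) j).
  replace (S d + j)%nat with (S j + d)%nat in E3 by lia.
  rewrite E2, !CofNat_S in E3.
  replace (A + 1 / 2 + (CofNat d + 1)) with (A + (CofNat d + 1) + 1 / 2) in E3
    by ring.
  rewrite E1, CofNat_S.
  transitivity (poch (A - 1 / 2 - CofNat j + 1) j
    * (poch (A + 1 / 2) (S j) * poch (A + 1 / 2 + (CofNat j + 1)) d)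
    / poch (A + 1) d / CofNat (fact (S (2 * j)))).
  { field; split; auto using fact_neq_0_C. }
  rewrite E3; field; split; auto using fact_neq_0_C.
Qed.

(** The same double splitting, with the symbols now in denominators. The third hypothesis excludes,
    for each [k], finitely many [A] at which the right-hand side may well be regular; hence the
    passage to limits in [A] below. *)
Lemma binom_fl_nonpos (A : C) (n k : nat) :
  poch (A - CofNat n) (S n) <> 0 ->
  poch (A + 1 / 2 - CofNat n) n <> 0 ->
  poch (A + 1 / 2 * CofNat k - CofNat n) (S n) <> 0 ->
  binom (A + 1 / 2 * CofNat k) k * fl (- Z.of_nat n) A (1 / 2) k
  = series_coef A (A - CofNat n) (odd_const (- Z.of_nat n) A) k.
Proof.
intros H1 H2 H3; unfold fl, odd_const.
replace (- Z.of_nat n - 1)%Z with (- Z.of_nat (S n))%Z by lia.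
rewrite !pochZ_nonpos.
replace (A + 1 - CofNat (S n)) with (A - CofNat n) by (rewrite CofNat_S; ring).
replace (A + 1 / 2 * CofNat k + 1 - CofNat (S n))
  with (A + 1 / 2 * CofNat k - CofNat n) by (rewrite CofNat_S; ring).
destruct (even_or_odd k) as [j [-> | ->]].
- rewrite series_coef_even; unfold binom; rewrite CofNat_double in *.
  rewrite (Cmult_assoc (Cpow (-1) j)), poch_opp_reflect.
  replace (A + 1 / 2 * (2 * CofNat j) - 2 * CofNat j + 1)
    with (A - CofNat j + 1) by field.
  replace (A + 1 / 2 * (2 * CofNat j) - CofNat n) with (A - CofNat n + CofNat j)
    in * by field.
  assert (E1 := poch_add (A - CofNat j + 1) j j).
  replace (j + j)%nat with (2 * j)%nat in E1 by lia.
  replace (A - CofNat j + 1 + CofNat j) with (A + 1) in E1 by ring.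
  assert (E2 := poch_add (A - CofNat n) j (S n)).
  assert (E3 := poch_add (A - CofNat n) (S n) j).
  replace (S n + j)%nat with (j + S n)%nat in E3 by lia.
  replace (A - CofNat n + CofNat (S n)) with (A + 1) in E3
    by (rewrite CofNat_S; ring).
  rewrite E2 in E3; rewrite E1.
  transitivity (poch (A - CofNat j + 1) j
    * (poch (A - CofNat n) (S n) * poch (A + 1) j)
    / poch (A - CofNat n + CofNat j) (S n) / CofNat (fact (2 * j))).
  { field; repeat split; auto using fact_neq_0_C. }
  rewrite <- E3; field; repeat split; auto using fact_neq_0_C.
- rewrite series_coef_odd; unfold binom; rewrite !CofNat_S, CofNat_double in *.
  replace (- A + 1 / 2) with (- (A - 1 / 2)) by ring.
  replace (Cpow (-1) j * (/ poch (A + 1 / 2 - CofNat n) n / / poch (A - CofNat n) (S n)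
    * (poch (- (A - 1 / 2)) j * poch (A - CofNat n + 1 / 2) j)))
  with (/ poch (A + 1 / 2 - CofNat n) n / / poch (A - CofNat n) (S n)
    * ((Cpow (-1) j * poch (- (A - 1 / 2)) j) * poch (A - CofNat n + 1 / 2) j))
    by ring.
  rewrite poch_opp_reflect.
  replace (A + 1 / 2 * (2 * CofNat j + 1) - (2 * CofNat j + 1) + 1)
    with (A - 1 / 2 - CofNat j + 1) by field.
  replace (A + 1 / 2 * (2 * CofNat j + 1) - CofNat n)
    with (A - CofNat n + 1 / 2 + CofNat j) in * by field.
  replace (A + 1 / 2 - CofNat n) with (A - CofNat n + 1 / 2) in * by ring.
  assert (E1 := poch_add (A - 1 / 2 - CofNat j + 1) j (S j)).
  replace (j + S j)%nat with (S (2 * j)) in E1 by lia.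
  replace (A - 1 / 2 - CofNat j + 1 + CofNat j) with (A + 1 / 2) in E1 by field.
  assert (E2 := poch_add (A - CofNat n + 1 / 2) j (S n)).
  assert (E3 := poch_add (A - CofNat n + 1 / 2) n (S j)).
  replace (n + S j)%nat with (j + S n)%nat in E3 by lia.
  replace (A - CofNat n + 1 / 2 + CofNat n) with (A + 1 / 2) in E3 by ring.
  rewrite E2 in E3; rewrite E1.
  apply (Cmult_cancel_r (poch (A - CofNat n + 1 / 2) n)); [exact H2|].
  transitivity (poch (A - 1 / 2 - CofNat j + 1) j * poch (A - CofNat n) (S n)
    * (poch (A - CofNat n + 1 / 2) n * poch (A + 1 / 2) (S j))
    / poch (A - CofNat n + 1 / 2 + CofNat j) (S n) / CofNat (fact (S (2 * j)))).
  { field; repeat split; auto using fact_neq_0_C. }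
  rewrite <- E3; field; repeat split; auto using fact_neq_0_C.
Qed.

(** * Growth and parity of the coefficients *)

(** Both parities have two symbols of length [j] over [k!] with [2 j <= k], and
    [j! j! <= (2 j)! <= k!]. *)
Lemma geom_dominated_series_coef (A e cst : C) :
  geom_dominated (series_coef A e cst).
Proof.
destruct (ex_nat_ge_Cmod (- A)) as [m1 H1].
destruct (ex_nat_ge_Cmod e) as [m2 H2].
destruct (ex_nat_ge_Cmod (- A + 1 / 2)) as [m3 H3].
destruct (ex_nat_ge_Cmod (e + 1 / 2)) as [m4 H4].
set (M1 := (2 ^ m1 * 2 ^ m2)%R); set (M2 := (Cmod cst * (2 ^ m3 * 2 ^ m4))%R).
assert (P1 : (0 <= M1)%R) by (apply Rmult_le_pos; apply pow_le; lra).
assert (P2 : (0 <= M2)%R).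
{ apply Rmult_le_pos; [apply Cmod_ge_0|apply Rmult_le_pos; apply pow_le; lra]. }
exists (M1 + M2)%R, 2%R; split; [lra|split; [lra|]]; intros k.
assert (Hgen : forall (c1 c2 : C) (n1 n2 j : nat),
  (Cmod c1 <= INR n1)%R -> (Cmod c2 <= INR n2)%R -> (2 * j <= k)%nat ->
  (Cmod (poch c1 j * poch c2 j) <= 2 ^ n1 * 2 ^ n2 * (2 ^ k * INR (fact k)))%R).
{ intros c1 c2 n1 n2 j Hc1 Hc2 Hj.
  rewrite Cmod_mult.
  eapply Rle_trans; [apply Rmult_le_compat; try apply Cmod_ge_0;
    [exact (Cmod_poch_le c1 n1 j Hc1)|exact (Cmod_poch_le c2 n2 j Hc2)]|].
  rewrite !pow_add.
  replace (2 ^ n1 * 2 ^ j * INR (fact j) * (2 ^ n2 * 2 ^ j * INR (fact j)))%R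
    with (2 ^ n1 * 2 ^ n2 * (2 ^ (j + j) * (INR (fact j) * INR (fact j))))%R
    by (rewrite pow_add; ring).
  apply Rmult_le_compat_l; [apply Rmult_le_pos; apply pow_le; lra|].
  apply Rmult_le_compat.
  - apply pow_le; lra.
  - apply Rmult_le_pos; apply pos_INR.
  - apply Rle_pow; [lra|lia].
  - eapply Rle_trans; [apply fact_mult_le|].
    apply le_INR, fact_le; lia. }
assert (Q := INR_fact_lt_0 k).
unfold series_coef.
rewrite Cmod_div, Cmod_mult, Cmod_pow, Cmod_CofNat by apply fact_neq_0_C.
replace (Cmod (-1)) with 1%R
  by (replace (RtoC (-1)) with (- RtoC 1) by (rewrite <- RtoC_opp; reflexivity);
      now rewrite Cmod_m1).
rewrite pow1, Rmult_1_l.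
apply Rmult_le_reg_r with (INR (fact k)); [exact Q|].
unfold Rdiv; rewrite Rmult_assoc, Rinv_l, Rmult_1_r by lra.
assert (Hj : (2 * Nat.div2 k <= k)%nat).
{ destruct (even_or_odd k) as [j [-> | ->]];
    rewrite ?Nat.div2_double, ?Nat.div2_succ_double; lia. }
assert (P3 : (0 <= 2 ^ k * INR (fact k))%R)
  by (apply Rmult_le_pos; [apply pow_le|]; lra).
destruct (Nat.even k).
- eapply Rle_trans; [apply (Hgen _ _ m1 m2); assumption|fold M1; nra].
- rewrite Cmod_mult.
  eapply Rle_trans.
  + apply Rmult_le_compat_l; [apply Cmod_ge_0|].
    apply (Hgen _ _ m3 m4); assumption.
  + rewrite <- Rmult_assoc; fold M2; nra.
Qed.

Lemma geom_dominated_mult_bounded (u v : nat -> C) (D : R) :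
  geom_dominated u -> (forall k, (Cmod (v k) <= D)%R) ->
  geom_dominated (fun k => u k * v k).
Proof.
intros [M [K [HM [HK H]]]] Hv.
assert (HD : (0 <= D)%R) by (eapply Rle_trans; [apply (Cmod_ge_0 (v O))|apply Hv]).
exists (M * D)%R, K; split; [now apply Rmult_le_pos|split; [exact HK|]].
intros n; rewrite Cmod_mult.
replace (M * D * K ^ n)%R with (M * K ^ n * D)%R by ring.
apply Rmult_le_compat; auto using Cmod_ge_0.
Qed.

Lemma bounded_inv_arith (g : C) :
  (forall k, g + 1 / 2 * CofNat k <> 0) ->
  exists D : R, forall k, (Cmod (g / (g + 1 / 2 * CofNat k)) <= D)%R.
Proof.
intros H.
destruct (ex_nat_ge_Cmod g) as [m Hm].
assert (HF : forall N, exists D : R, forall k, (k < N)%nat ->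
  (Cmod (g / (g + 1 / 2 * CofNat k)) <= D)%R).
{ induction N as [|N [D HD]]; [exists 0%R; intros; lia|].
  exists (Rmax D (Cmod (g / (g + 1 / 2 * CofNat N)))); intros k Hk.
  destruct (Nat.eq_dec k N) as [->|]; [apply Rmax_r|].
  eapply Rle_trans; [apply HD; lia|apply Rmax_l]. }
(* From this index on [k / 2 >= |g| + 1], so the denominator has modulus at least 1. *)
destruct (HF (2 * (m + 1))%nat) as [D HD].
exists (Rmax D (Cmod g)); intros k.
destruct (le_lt_dec (2 * (m + 1)) k) as [Hk|Hk].
- eapply Rle_trans; [|apply Rmax_r].
  rewrite Cmod_div by apply H.
  assert (P := Cmod_ge_0 g).
  assert (Q : (1 <= Cmod (g + 1 / 2 * CofNat k))%R).
  { replace (1 / 2 * CofNat k) with ((g + 1 / 2 * CofNat k) + - g) by ring.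
    assert (T := Cmod_triangle (g + 1 / 2 * CofNat k) (- g)).
    rewrite Cmod_opp in T.
    replace (g + 1 / 2 * CofNat k + - g) with (RtoC (1 / 2) * CofNat k) in T.
    2:{ rewrite RtoC_div by lra; ring. }
    rewrite Cmod_mult, Cmod_CofNat, Cmod_R, Rabs_pos_eq in T by lra.
    apply le_INR in Hk; rewrite mult_INR, plus_INR in Hk; simpl in Hk.
    replace (g + (g + 1 / 2 * CofNat k + - g)) with (g + 1 / 2 * CofNat k) by ring.
    lra. }
  apply Rmult_le_reg_r with (Cmod (g + 1 / 2 * CofNat k)); [lra|].
  unfold Rdiv; rewrite Rmult_assoc, Rinv_l by lra; nra.
- eapply Rle_trans; [apply HD, Hk|apply Rmax_l].
Qed.

Lemma Csum_even (t : nat -> C) (n : nat) :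
  (forall j, t (S (2 * j)) = 0) ->
  Csum t (2 * n) = Csum (fun j => t (2 * j)%nat) n.
Proof.
intros H; induction n as [|n IH]; [reflexivity|].
replace (2 * S n)%nat with (S (S (2 * n))) by lia.
rewrite !Csum_S, IH, H.
replace (2 * S n)%nat with (S (S (2 * n))) by lia; ring.
Qed.

Lemma Csum_odd (t : nat -> C) (n : nat) :
  (forall j, t (2 * j)%nat = 0) ->
  Csum t (S (2 * n)) = Csum (fun j => t (S (2 * j))) n.
Proof.
intros H; induction n as [|n IH].
- rewrite Csum_S, !Csum_O; assert (H0 := H O); simpl in *; rewrite H0; ring.
- replace (2 * S n)%nat with (S (S (2 * n))) by lia.
  rewrite Csum_S, (Csum_S _ (S (2 * n))), IH, Csum_S.
  assert (H1 := H (S n)).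
  replace (2 * S n)%nat with (S (S (2 * n))) in * by lia; rewrite H1; ring.
Qed.

Lemma is_Cseries_subseq (u v : nat -> C) (phi : nat -> nat) (L : C) :
  (forall n, (n <= phi n)%nat) -> (forall n, Csum v n = Csum u (phi n)) ->
  is_Cseries u L -> is_Cseries v L.
Proof.
intros Hphi E H; apply is_Cseries_epsilon; intros eps He.
destruct (proj1 (is_Cseries_epsilon u L) H eps He) as [N HN].
exists N; intros n Hn; rewrite E; apply HN; specialize (Hphi n); lia.
Qed.

Lemma Cpow_opp_even (x : C) (j : nat) : Cpow (- x) (2 * j) = Cpow x (2 * j).
Proof.
rewrite !Cpow_mult_r; f_equal; rewrite !Cpow_S; simpl; ring.
Qed.

Lemma Cpow_opp_odd (x : C) (j : nat) : Cpow (- x) (S (2 * j)) = - Cpow x (S (2 * j)).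
Proof. rewrite !(Cpow_S _ (2 * j)), Cpow_opp_even; ring. Qed.

Lemma even_part (w : nat -> C) (x S1 S2 : C) :
  is_Cseries (fun k => w k * Cpow x k) S1 ->
  is_Cseries (fun k => w k * Cpow (- x) k) S2 ->
  is_Cseries (fun j => w (2 * j)%nat * Cpow x (2 * j)) (1 / 2 * (S1 + S2)).
Proof.
intros H1 H2.
assert (H := is_Cseries_scal (1 / 2) _ _ (is_Cseries_plus _ _ _ _ H1 H2)).
revert H; apply is_Cseries_subseq with (phi := fun n => (2 * n)%nat); [lia|].
intros n; rewrite Csum_even.
- apply Csum_ext; intros j _; rewrite Cpow_opp_even; field.
- intros j; rewrite Cpow_opp_odd; ring.
Qed.

Lemma odd_part (w : nat -> C) (x S1 S2 : C) :
  is_Cseries (fun k => w k * Cpow x k) S1 ->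
  is_Cseries (fun k => w k * Cpow (- x) k) S2 ->
  is_Cseries (fun j => w (S (2 * j)) * Cpow x (S (2 * j))) (1 / 2 * (S1 - S2)).
Proof.
intros H1 H2.
assert (H := is_Cseries_scal (1 / 2) _ _
  (is_Cseries_plus _ _ _ _ H1 (is_Cseries_scal (-1) _ _ H2))).
replace (S1 - S2) with (S1 + -1 * S2) by ring.
revert H; apply is_Cseries_subseq with (phi := fun n => (S (2 * n))%nat); [lia|].
intros n; rewrite Csum_odd.
- apply Csum_ext; intros j _; rewrite Cpow_opp_odd; field.
- intros j; rewrite Cpow_opp_even; ring.
Qed.

(** * Limits in the parameter *)

Lemma locally_Cmod (x : C) (P : C -> Prop) :
  locally (T := C_UniformSpace) x P <->
  exists d : R, (0 < d)%R /\ forall y, (Cmod (y - x) < d)%R -> P y.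
Proof.
rewrite locally_C; split.
- intros [d H]; exists d; split; [apply cond_pos|exact H].
- intros [d [Hd H]]; exists (mkposreal d Hd); exact H.
Qed.

Definition Ccont (f : C -> C) (x : C) : Prop :=
  forall eps : R, (0 < eps)%R -> exists d : R, (0 < d)%R /\
    forall y, (Cmod (y - x) < d)%R -> (Cmod (f y - f x) < eps)%R.

Lemma Ccont_const (c x : C) : Ccont (fun _ => c) x.
Proof.
intros eps He; exists 1%R; split; [lra|]; intros y _.
unfold Cminus; rewrite Cplus_opp_r, Cmod_0; exact He.
Qed.

Lemma Ccont_id (x : C) : Ccont (fun y => y) x.
Proof. intros eps He; exists eps; auto. Qed.

Lemma Ccont_plus (f g : C -> C) (x : C) :
  Ccont f x -> Ccont g x -> Ccont (fun y => f y + g y) x.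
Proof.
intros Hf Hg eps He.
destruct (Hf (eps / 2)%R ltac:(lra)) as [d1 [Hd1 H1]].
destruct (Hg (eps / 2)%R ltac:(lra)) as [d2 [Hd2 H2]].
exists (Rmin d1 d2); split; [now apply Rmin_glb_lt|]; intros y Hy.
assert (E1 := H1 y (Rlt_le_trans _ _ _ Hy (Rmin_l _ _))).
assert (E2 := H2 y (Rlt_le_trans _ _ _ Hy (Rmin_r _ _))).
replace (f y + g y - (f x + g x)) with ((f y - f x) + (g y - g x)) by ring.
eapply Rle_lt_trans; [apply Cmod_triangle|lra].
Qed.

Lemma Ccont_mult (f g : C -> C) (x : C) :
  Ccont f x -> Ccont g x -> Ccont (fun y => f y * g y) x.
Proof.
intros Hf Hg eps He.
assert (Pf := Cmod_ge_0 (f x)); assert (Pg := Cmod_ge_0 (g x)).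
set (K := (Cmod (f x) + Cmod (g x) + 1)%R).
set (e := Rmin 1 (eps / (2 * K))).
assert (HK : (0 < / (2 * K))%R) by (apply Rinv_0_lt_compat; unfold K; lra).
assert (He0 : (0 < e)%R) by (apply Rmin_glb_lt; [lra|]; unfold Rdiv; nra).
assert (He1 : (e <= 1)%R) by apply Rmin_l.
assert (He2 : (e * K < eps)%R).
{ apply Rle_lt_trans with (eps / (2 * K) * K)%R.
  - apply Rmult_le_compat_r; [unfold K; lra|apply Rmin_r].
  - replace (eps / (2 * K) * K)%R with (eps / 2)%R by (field; unfold K; lra); lra. }
destruct (Hf e He0) as [d1 [Hd1 H1]].
destruct (Hg e He0) as [d2 [Hd2 H2]].
exists (Rmin d1 d2); split; [now apply Rmin_glb_lt|]; intros y Hy.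
assert (E1 := H1 y (Rlt_le_trans _ _ _ Hy (Rmin_l _ _))).
assert (E2 := H2 y (Rlt_le_trans _ _ _ Hy (Rmin_r _ _))).
replace (f y * g y - f x * g x)
  with ((f y - f x) * (g y - g x) + (f x * (g y - g x) + (f y - f x) * g x)) by ring.
eapply Rle_lt_trans; [apply Cmod_triangle|].
eapply Rle_lt_trans; [apply Rplus_le_compat_l, Cmod_triangle|].
rewrite !Cmod_mult.
assert (Q1 := Cmod_ge_0 (f y - f x)); assert (Q2 := Cmod_ge_0 (g y - g x)).
unfold K in He2; nra.
Qed.

Lemma Ccont_inv (f : C -> C) (x : C) :
  Ccont f x -> f x <> 0 -> Ccont (fun y => / f y) x.
Proof.
intros Hf H0 eps He.
assert (Hp := proj1 (Cmod_gt_0 _) H0).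
set (m := Cmod (f x)) in *.
destruct (Hf (Rmin (m / 2) (eps * (m * m) / 2))) as [d [Hd H]].
{ apply Rmin_glb_lt; [lra|]; assert (0 < m * m)%R by nra.
  assert (0 < eps * (m * m))%R by nra; lra. }
exists d; split; [exact Hd|]; intros y Hy.
specialize (H y Hy).
assert (E1 := Rlt_le_trans _ _ _ H (Rmin_l _ _)).
assert (E2 := Rlt_le_trans _ _ _ H (Rmin_r _ _)).
assert (Q : (m / 2 < Cmod (f y))%R).
{ assert (T := Cmod_triangle (f y) (- (f y - f x))).
  replace (f y + - (f y - f x)) with (f x) in T by ring.
  rewrite Cmod_opp in T; fold m in T; lra. }
assert (Hy0 : f y <> 0) by (apply Cmod_gt_0; lra).
replace (/ f y - / f x) with (- (f y - f x) / (f y * f x)) by (field; auto).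
rewrite Cmod_div, Cmod_opp, Cmod_mult by (apply Cmult_neq_0; assumption).
fold m; apply Rmult_lt_reg_r with (Cmod (f y) * m)%R; [nra|].
unfold Rdiv; rewrite Rmult_assoc, Rinv_l, Rmult_1_r by nra.
eapply Rlt_le_trans; [exact E2|].
assert (eps * (m * (m / 2)) <= eps * (Cmod (f y) * m))%R; [|lra].
apply Rmult_le_compat_l; nra.
Qed.

Lemma Ccont_Csum (f : nat -> C -> C) (n : nat) (x : C) :
  (forall k, (k <= n)%nat -> Ccont (f k) x) ->
  Ccont (fun y => Csum (fun k => f k y) n) x.
Proof.
induction n as [|n IH]; intros H.
- intros eps He; destruct (H O (le_n O) eps He) as [d [Hd Q]].
  exists d; split; [exact Hd|]; intros y Hy; rewrite !Csum_O; auto.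
- intros eps He.
  destruct (Ccont_plus (fun y => Csum (fun k => f k y) n) (f (S n)) x
    (IH (fun k Hk => H k ltac:(lia))) (H (S n) ltac:(lia)) eps He) as [d [Hd Q]].
  exists d; split; [exact Hd|]; intros y Hy; rewrite !Csum_S; auto.
Qed.

Lemma Ccont_poch (f : C -> C) (n : nat) (x : C) :
  Ccont f x -> Ccont (fun y => poch (f y) n) x.
Proof.
intros H; induction n as [|n IH].
- apply (Ccont_const 1).
- apply (Ccont_mult (fun y => poch (f y) n)); [exact IH|].
  apply Ccont_plus; [exact H|apply Ccont_const].
Qed.

Lemma filterlim_Ccont (f : C -> C) (x : C) :
  Ccont f x ->
  filterlim f (locally' (T := C_UniformSpace) x)
    (locally (T := C_UniformSpace) (f x)).
Proof.
intros H P HP; apply locally_Cmod in HP; destruct HP as [e [He HP]].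
destruct (H e He) as [d [Hd Q]].
assert (L : locally (T := C_UniformSpace) x (fun y => P (f y)))
  by (apply locally_Cmod; exists d; split; auto).
unfold filtermap, locally', within.
revert L; apply filter_imp; auto.
Qed.

Lemma locally'_neq (f : C -> C) (x : C) :
  Ccont f x -> f x <> 0 ->
  locally' (T := C_UniformSpace) x (fun y => f y <> 0).
Proof.
intros H H0; unfold locally', within.
apply (filter_imp (fun y => f y <> 0)); [auto|].
apply locally_Cmod.
destruct (H (Cmod (f x)) (proj1 (Cmod_gt_0 _) H0)) as [d [Hd Q]].
exists d; split; [exact Hd|]; intros y Hy E.
specialize (Q y Hy); rewrite E in Q.
replace (0 - f x) with (- f x) in Q by ring; rewrite Cmod_opp in Q; lra.
Qed.

(** Each linear factor has a single zero, and if that zero is [x] the punctured neighbourhood omits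
    it; so the symbol may vanish at [x] itself. *)
Lemma locally'_poch_neq_0 (c x : C) (n : nat) :
  locally' (T := C_UniformSpace) x (fun y => poch (y + c) n <> 0).
Proof.
induction n as [|n IH].
- apply filter_forall; intros y; apply C1_nz.
- assert (H : locally' (T := C_UniformSpace) x (fun y => y + c + CofNat n <> 0)).
  { destruct (Ceq_dec (x + c + CofNat n) 0) as [E|E].
    - unfold locally', within; apply filter_forall; intros y Hy; change (y <> x :> C) in Hy; intros E'.
      apply Hy; change (@eq C y x).
      replace (y : C) with (y + c + CofNat n - (c + CofNat n)) by ring.
      rewrite E', <- E; ring.
    - apply (locally'_neq (fun y => y + c + CofNat n)); [|exact E].
      repeat apply Ccont_plus; auto using Ccont_id, Ccont_const. }
  generalize (filter_and _ _ IH H); apply filter_imp.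
  intros y [H1 H2]; rewrite poch_S; now apply Cmult_neq_0.
Qed.

Lemma filter_forall_le {T : Type} {F : (T -> Prop) -> Prop} {FF : Filter F}
  (P : nat -> T -> Prop) (n : nat) :
  (forall k, F (P k)) -> F (fun x => forall k, (k <= n)%nat -> P k x).
Proof.
intros H; induction n as [|n IH].
- generalize (H O); apply filter_imp; intros x Hx k Hk.
  now replace k with O by lia.
- generalize (filter_and _ _ IH (H (S n))); apply filter_imp.
  intros x [H1 H2] k Hk; destruct (Nat.eq_dec k (S n)) as [->|]; [exact H2|].
  apply H1; lia.
Qed.

Lemma locally'_proper (x : C) : ProperFilter' (locally' (T := C_UniformSpace) x).
Proof.
split; [|apply within_filter, locally_filter].
intros H; unfold locally', within in H; apply locally_Cmod in H.
destruct H as [d [Hd H]].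
apply (H (x + RtoC (d / 2))).
- replace (x + RtoC (d / 2) - x) with (RtoC (d / 2)) by ring.
  rewrite Cmod_R, Rabs_pos_eq; lra.
- intros E.
  assert (E' : RtoC (d / 2) = 0).
  { replace (RtoC (d / 2)) with (x + RtoC (d / 2) - x) by ring.
    rewrite E; ring. }
  apply RtoC_inj in E'; lra.
Qed.

Lemma filterlim_locally'_unique (f : C -> C) (x a b : C) :
  filterlim f (locally' (T := C_UniformSpace) x) (locally (T := C_UniformSpace) a) ->
  filterlim f (locally' (T := C_UniformSpace) x) (locally (T := C_UniformSpace) b) ->
  a = b.
Proof.
assert (PF := locally'_proper x).
intros Ha Hb.
apply (filterlim_locally_unique (K := C_AbsRing) (V := C_NormedModule)
         (F := locally' (T := C_UniformSpace) x) f); [exact Ha|exact Hb].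
Qed.

Lemma Ccont_ext (f g : C -> C) (x : C) :
  (forall y, f y = g y) -> Ccont f x -> Ccont g x.
Proof.
intros E H; replace g with f; [exact H|].
now apply functional_extensionality.
Qed.

Lemma Ccont_series_coef (c x : C) (cst : C -> C) (k : nat) :
  Ccont cst x -> Ccont (fun A => series_coef A (A + c) (cst A) k) x.
Proof.
intros H; unfold series_coef, Cdiv.
assert (N : Ccont (fun A => - A) x).
{ apply Ccont_ext with (fun A => (-1) * A); [intros; ring|].
  apply Ccont_mult; auto using Ccont_const, Ccont_id. }
apply Ccont_mult; [|apply Ccont_const].
apply Ccont_mult; [apply Ccont_const|].
destruct (Nat.even k).
- apply Ccont_mult; apply Ccont_poch; [exact N|].
  apply Ccont_plus; auto using Ccont_const, Ccont_id.
- apply Ccont_mult; [exact H|].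
  apply Ccont_mult; apply Ccont_poch; repeat apply Ccont_plus;
    auto using Ccont_const, Ccont_id.
Qed.

Lemma Ccont_transform (B x : C) (w : C -> nat -> C) (r : nat) :
  (forall k, (k <= r)%nat -> Ccont (fun A => w A k) x) ->
  Ccont (fun A => transform A B (w A) r) x.
Proof.
intros H; unfold transform.
apply (Ccont_Csum (fun k A => (-1) ^ k
  * binom (A + B * CofNat k - CofNat k) (r - k) * w A k)).
intros k Hk; apply Ccont_mult; [|now apply H].
apply Ccont_mult; [apply Ccont_const|]; unfold binom, Cdiv, Cminus.
apply Ccont_mult; [|apply Ccont_const].
apply Ccont_poch; repeat apply Ccont_plus; auto using Ccont_const, Ccont_id.
Qed.

Lemma fhat_sum_transform (l : Z) (A B : C) (w : nat -> C) (r : nat) :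
  (forall k, (k <= r)%nat -> binom (A + B * CofNat k) k * fl l A B k = w k) ->
  fhat_sum l A B r = transform A B w r.
Proof.
intros H; rewrite fhat_sum_binom_diff, <- transform_binom.
unfold transform; apply Csum_ext; intros k Hk; now rewrite H.
Qed.

(** Off the poles [fhat_sum] agrees with [transform] of the closed-form weights, which is continuous
    at [A] itself; its value there is therefore the limit. *)
Lemma is_fhat_transform (l : Z) (A B : C) (w : C -> nat -> C) (r : nat) :
  locally' (T := C_UniformSpace) A (fun A' =>
    forall k, (k <= r)%nat -> binom (A' + B * CofNat k) k * fl l A' B k = w A' k) ->
  (forall k, (k <= r)%nat -> Ccont (fun A' => w A' k) A) ->
  is_fhat l A B r (transform A B (w A) r).
Proof.
intros H HC; unfold is_fhat.
apply filterlim_ext_loc with (fun A' => transform A' B (w A') r).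
- revert H; apply filter_imp; intros A' HA; symmetry; now apply fhat_sum_transform.
- apply (filterlim_Ccont (fun A' => transform A' B (w A') r)).
  now apply Ccont_transform.
Qed.

Lemma Ccont_odd_const_pos (A : C) (d : nat) :
  poch (A + 1) d <> 0 -> Ccont (odd_const (Z.of_nat (S d))) A.
Proof.
intros H.
apply Ccont_ext with (fun A => poch (A + 1 / 2) (S d) * / poch (A + 1) d).
{ intros y; unfold odd_const.
  replace (Z.of_nat (S d) - 1)%Z with (Z.of_nat d) by lia.
  rewrite !pochZ_nonneg; reflexivity. }
apply Ccont_mult; [|apply Ccont_inv; [|exact H]]; apply Ccont_poch, Ccont_plus;
  auto using Ccont_const, Ccont_id.
Qed.

Lemma is_fhat_pos (A : C) (d r : nat) :
  poch (A + 1) d <> 0 ->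
  is_fhat (Z.of_nat (S d)) A (1 / 2) r
    (transform A (1 / 2)
      (series_coef A (A + CofNat (S d)) (odd_const (Z.of_nat (S d)) A)) r).
Proof.
intros H.
apply (is_fhat_transform _ _ _ (fun A =>
  series_coef A (A + CofNat (S d)) (odd_const (Z.of_nat (S d)) A))).
- generalize (locally'_poch_neq_0 1 A d); apply filter_imp; intros A' HA k _.
  now apply binom_fl_pos.
- intros k _; apply (Ccont_series_coef (CofNat (S d)) A).
  now apply Ccont_odd_const_pos.
Qed.

Lemma odd_const_nonpos (n : nat) (A : C) :
  odd_const (- Z.of_nat n) A
  = / poch (A + (1 / 2 - CofNat n)) n * / / poch (A + - CofNat n) (S n).
Proof.
unfold odd_const.
replace (- Z.of_nat n - 1)%Z with (- Z.of_nat (S n))%Z by lia.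
rewrite !pochZ_nonpos, CofNat_S.
replace (A + 1 - (CofNat n + 1)) with (A + - CofNat n) by ring.
replace (A + 1 / 2 - CofNat n) with (A + (1 / 2 - CofNat n)) by ring.
reflexivity.
Qed.

Lemma locally'_binom_fl_nonpos (A : C) (n r : nat) :
  locally' (T := C_UniformSpace) A (fun A' =>
    (poch (A' + - CofNat n) (S n) <> 0
     /\ poch (A' + (1 / 2 - CofNat n)) n <> 0)
    /\ forall k, (k <= r)%nat ->
       poch (A' + 1 / 2 * CofNat k - CofNat n) (S n) <> 0 /\
       binom (A' + 1 / 2 * CofNat k) k * fl (- Z.of_nat n) A' (1 / 2) k
       = series_coef A' (A' + - CofNat n) (odd_const (- Z.of_nat n) A') k).
Proof.
assert (H1 := locally'_poch_neq_0 (- CofNat n) A (S n)).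
assert (H2 := locally'_poch_neq_0 (1 / 2 - CofNat n) A n).
assert (H3 := filter_forall_le (F := locally' (T := C_UniformSpace) A) _ r
  (fun k => locally'_poch_neq_0 (1 / 2 * CofNat k - CofNat n) A (S n))).
generalize (filter_and _ _ (filter_and _ _ H1 H2) H3); apply filter_imp.
intros A' [[Q1 Q2] Q3]; split; [now split|]; intros k Hk.
specialize (Q3 k Hk).
assert (Q3' : poch (A' + 1 / 2 * CofNat k - CofNat n) (S n) <> 0).
{ replace (A' + 1 / 2 * CofNat k - CofNat n)
    with (A' + (1 / 2 * CofNat k - CofNat n) : C) by (cbv [Cminus]; apply Cplus_assoc).
  exact Q3. }
split; [exact Q3'|].
apply binom_fl_nonpos; [exact Q1| |exact Q3'].
replace (A' + 1 / 2 - CofNat n) with (A' + (1 / 2 - CofNat n) : C)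
  by (cbv [Cminus]; apply Cplus_assoc).
exact Q2.
Qed.

Lemma is_fhat_nonpos (A : C) (n r : nat) :
  poch (A - CofNat n) (S n) <> 0 -> poch (A + (1 / 2 - CofNat n)) n <> 0 ->
  is_fhat (- Z.of_nat n) A (1 / 2) r
    (transform A (1 / 2)
      (series_coef A (A - CofNat n) (odd_const (- Z.of_nat n) A)) r).
Proof.
intros H1 H2.
apply (is_fhat_transform _ _ _ (fun A =>
  series_coef A (A - CofNat n) (odd_const (- Z.of_nat n) A))).
- generalize (locally'_binom_fl_nonpos A n r); apply filter_imp.
  intros A' [_ H] k Hk; now apply H.
- intros k _; apply (Ccont_series_coef (- CofNat n) A).
  apply Ccont_ext with (fun A => / poch (A + (1 / 2 - CofNat n)) n
                                 * / / poch (A + - CofNat n) (S n)).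
  { intros y; symmetry; apply odd_const_nonpos. }
  apply Ccont_mult.
  + apply Ccont_inv; [|exact H2].
    apply Ccont_poch, Ccont_plus; auto using Ccont_const, Ccont_id.
  + apply Ccont_inv; [apply Ccont_inv; [|exact H1]|].
    * apply Ccont_poch, Ccont_plus; auto using Ccont_const, Ccont_id.
    * intros E; apply C1_nz.
      rewrite <- (Cinv_l _ H1); unfold Cminus; rewrite E; ring.
Qed.

Lemma transform_1 (A B : C) (w : nat -> C) :
  transform A B w 1 = A * w O - w 1%nat.
Proof.
unfold transform; rewrite Csum_S, Csum_O; simpl (1 - 0)%nat; simpl (1 - 1)%nat.
rewrite binom_0, CofNat_0; unfold binom; simpl.
change (CofNat 1) with (RtoC 1); rewrite CofNat_0; field.
Qed.

Lemma series_coef_0 (A e cst : C) : series_coef A e cst 0 = 1.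
Proof. unfold series_coef; simpl; change (CofNat 1) with (RtoC 1); field. Qed.

Lemma series_coef_1 (A e cst : C) : series_coef A e cst 1 = cst.
Proof. unfold series_coef; simpl; change (CofNat 1) with (RtoC 1); field. Qed.

(** Filling in the limit makes the rules for continuous functions available to a function controlled
    only off [x]. *)
Lemma Ccont_filled (f : C -> C) (x v : C) :
  filterlim f (locally' (T := C_UniformSpace) x) (locally (T := C_UniformSpace) v) ->
  Ccont (fun y => if Ceq_dec y x then v else f y) x.
Proof.
intros H eps He.
assert (L : locally (T := C_UniformSpace) v (fun z => Cmod (z - v) < eps)%R).
{ apply locally_Cmod; exists eps; auto. }
specialize (H _ L); unfold filtermap, locally', within in H.
apply locally_Cmod in H; destruct H as [d [Hd H]].
exists d; split; [exact Hd|]; intros y Hy.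
destruct (Ceq_dec x x) as [_|N]; [|congruence].
destruct (Ceq_dec y x) as [E|N]; [|now apply H].
unfold Cminus; rewrite Cplus_opp_r, Cmod_0; exact He.
Qed.

(* The first coefficient is [A - odd_const l A], so its regularity at [A] rules
   out the pole of [odd_const]. *)
Lemma F_defined_odd_const (A : C) (n : nat) :
  poch (A - CofNat n) (S n) <> 0 -> F_defined (- Z.of_nat n) A (1 / 2) ->
  poch (A + (1 / 2 - CofNat n)) n <> 0.
Proof.
intros H HF E; apply H.
destruct (HF 1%nat) as [v Hv].
assert (HC := Ccont_filled _ _ _ Hv).
(* Off [A] this is [p (A' - fhat_1) = p * odd_const = q], with [odd_const = q / p]. If [p] vanished
   at [A], the finite limit [v] would make [g], hence [q], tend to 0, against [H]. *)
set (g := fun A' => poch (A' + (1 / 2 - CofNat n)) n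
  * (A' + (-1) * (if Ceq_dec A' A then v else fhat_sum (- Z.of_nat n) A' (1 / 2) 1))).
assert (Hg : Ccont g A).
{ apply Ccont_mult.
  - apply Ccont_poch, Ccont_plus; auto using Ccont_const, Ccont_id.
  - apply Ccont_plus; [apply Ccont_id|].
    apply Ccont_mult; [apply Ccont_const|exact HC]. }
assert (Hp : Ccont (fun A' => poch (A' + - CofNat n) (S n)) A).
{ apply Ccont_poch, Ccont_plus; auto using Ccont_const, Ccont_id. }
apply filterlim_Ccont in Hg; apply filterlim_Ccont in Hp.
assert (Eg : g A = 0) by (unfold g; rewrite E; ring).
rewrite Eg in Hg.
refine (filterlim_locally'_unique _ A _ _ Hp _).
apply (filterlim_ext_loc g); [|exact Hg].
assert (Hne : locally' (T := C_UniformSpace) A (fun A' => A' <> A)).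
{ unfold locally', within; apply filter_forall; auto. }
generalize (filter_and _ _ Hne (locally'_binom_fl_nonpos A n 1)); apply filter_imp.
intros A' [N [[Q1 Q2] Q]]; unfold g.
destruct (Ceq_dec A' A) as [EA|_]; [now elim N|].
rewrite (fhat_sum_transform _ _ _
  (series_coef A' (A' + - CofNat n) (odd_const (- Z.of_nat n) A')))
  by (intros k Hk; now apply Q).
rewrite transform_1, series_coef_0, series_coef_1, odd_const_nonpos.
change (A' <> A :> C) in N.
set (p := poch _ n) in *; set (q := poch _ (S n)) in *.
clearbody p q.
field; split; assumption.
Qed.

(** For [r > n] the denominator of [fl] divides the numerator of [binom (A + k / 2) r], leaving a
    polynomial in [k] of degree [r - n - 1 < r], whose [r]-th difference vanishes. This holds for
    nearby generic parameters, and the limit carries it to [A]. *)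
Lemma transform_nonpos_0 (A : C) (n r : nat) :
  poch (A - CofNat n) (S n) <> 0 -> poch (A + (1 / 2 - CofNat n)) n <> 0 ->
  (n < r)%nat ->
  transform A (1 / 2)
    (series_coef A (A - CofNat n) (odd_const (- Z.of_nat n) A)) r = 0.
Proof.
intros H1 H2 Hr.
refine (filterlim_locally'_unique _ A _ _ (is_fhat_nonpos A n r H1 H2) _).
apply (filterlim_ext_loc (fun _ : C => RtoC 0));
  [|exact (filterlim_Ccont (fun _ => 0) A (Ccont_const 0 A))].
generalize (locally'_binom_fl_nonpos A n r); apply filter_imp.
intros A' [_ Q]; symmetry; rewrite fhat_sum_binom_diff.
assert (D := Cdiff_poch (A' - CofNat r + 1) (1 / 2) (r - S n) r ltac:(lia)).
replace (r - S n =? r)%nat with false in D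
  by (symmetry; apply Nat.eqb_neq; lia).
rewrite <- (Cmult_0_r (poch (A' - CofNat n) (S n) / CofNat (fact r))), <- D.
unfold binom_diff, Cdiff; rewrite <- Csum_scal; apply Csum_ext; intros k Hk.
destruct (Q k Hk) as [Q1 _].
unfold fl; replace (- Z.of_nat n - 1)%Z with (- Z.of_nat (S n))%Z by lia.
rewrite !pochZ_nonpos; unfold binom.
replace (A' + 1 - CofNat (S n)) with (A' - CofNat n) by (rewrite CofNat_S; ring).
replace (A' + 1 / 2 * CofNat k + 1 - CofNat (S n))
  with (A' + 1 / 2 * CofNat k - CofNat n) by (rewrite CofNat_S; ring).
assert (E := poch_add (A' - CofNat r + 1 + 1 / 2 * CofNat k) (r - S n) (S n)).
replace (r - S n + S n)%nat with r in E by lia.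
assert (ER : CofNat r = CofNat (r - S n) + CofNat n + 1)
  by (rewrite <- CofNat_plus, <- CofNat_S; f_equal; lia).
replace (A' - CofNat r + 1 + 1 / 2 * CofNat k + CofNat (r - S n))
  with (A' + 1 / 2 * CofNat k - CofNat n) in E by (rewrite ER; ring).
replace (A' + 1 / 2 * CofNat k - CofNat r + 1)
  with (A' - CofNat r + 1 + 1 / 2 * CofNat k) by ring.
rewrite E.
(* A vanishing normalizing symbol makes [fl] zero by [/ 0 = 0], and both sides are then 0. *)
destruct (Ceq_dec (poch (A' - CofNat n) (S n)) 0) as [Z0|Z0].
- rewrite Z0; unfold Cdiv.
  assert (I0 : / / 0 = 0).
  { now rewrite !Cinv_0. }
  rewrite I0; ring.
- field; repeat split; auto using fact_neq_0_C.
Qed.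

(** * Rationality of F *)

Definition twist (B : C) (h : nat -> C) (r : nat) : C := h r + B * shift_seq h r.

Definition rational_level (B : C) (m : nat) (h : nat -> C) : Prop :=
  exists N, forall n, (N < n)%nat -> Nat.iter m (twist B) h n = 0.

(* [twist B] multiplies the generating function by [1 + B u], so these are the
   sequences whose generating function is a polynomial over a power of
   [1 + B u]. *)
Definition rational_seq (B : C) (h : nat -> C) : Prop :=
  exists m, rational_level B m h.

Lemma iter_twist_S (B : C) (m : nat) (h : nat -> C) :
  Nat.iter (S m) (twist B) h = Nat.iter m (twist B) (twist B h).
Proof. apply Nat.iter_succ_r. Qed.

Lemma iter_twist_comm (B : C) (op : (nat -> C) -> nat -> C) (m : nat) :
  (forall h, twist B (op h) = op (twist B h)) ->
  forall h, Nat.iter m (twist B) (op h) = op (Nat.iter m (twist B) h).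
Proof.
intros H h; induction m as [|m IH]; [reflexivity|]; simpl; now rewrite IH.
Qed.

Lemma iter_twist_linear (B a b : C) (h g : nat -> C) (m : nat) :
  Nat.iter m (twist B) (fun r => a * h r + b * g r)
  = fun r => a * Nat.iter m (twist B) h r + b * Nat.iter m (twist B) g r.
Proof.
induction m as [|m IH]; [reflexivity|].
simpl; rewrite IH; apply functional_extensionality; intros r.
unfold twist; destruct r; simpl; ring.
Qed.

Lemma rational_level_S (B : C) (m : nat) (h : nat -> C) :
  rational_level B m h -> rational_level B (S m) h.
Proof.
intros [N HN]; exists (S N); intros n Hn; simpl; unfold twist at 1.
rewrite HN by lia; destruct n as [|n]; [lia|]; simpl; rewrite HN by lia; ring.
Qed.

Lemma rational_level_le (B : C) (m p : nat) (h : nat -> C) :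
  (m <= p)%nat -> rational_level B m h -> rational_level B p h.
Proof. intros H; induction H; auto using rational_level_S. Qed.

Lemma rational_seq_linear (B a b : C) (h g : nat -> C) :
  rational_seq B h -> rational_seq B g ->
  rational_seq B (fun r => a * h r + b * g r).
Proof.
intros [m1 H1] [m2 H2]; exists (Nat.max m1 m2).
apply (rational_level_le B m1 (Nat.max m1 m2)) in H1; [|lia].
apply (rational_level_le B m2 (Nat.max m1 m2)) in H2; [|lia].
destruct H1 as [N1 H1]; destruct H2 as [N2 H2].
exists (N1 + N2)%nat; intros n Hn.
rewrite iter_twist_linear, H1, H2 by lia; ring.
Qed.

Lemma rational_seq_shift (B : C) (h : nat -> C) :
  rational_seq B h -> rational_seq B (shift_seq h).
Proof.
intros [m [N H]]; exists m, (S N); intros n Hn.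
rewrite (iter_twist_comm B shift_seq).
- destruct n as [|n]; [lia|]; simpl; apply H; lia.
- intros g; apply functional_extensionality; intros [|r]; unfold twist; simpl; ring.
Qed.

Lemma rational_seq_twist (B : C) (h : nat -> C) :
  rational_seq B (twist B h) -> rational_seq B h.
Proof.
intros [m [N H]]; exists (S m), N; intros n Hn.
rewrite iter_twist_S; auto.
Qed.

Lemma rational_seq_ext (B : C) (h g : nat -> C) :
  (forall r, h r = g r) -> rational_seq B h -> rational_seq B g.
Proof.
intros E H; replace g with h; [exact H|]; now apply functional_extensionality.
Qed.

(** The index acts as [u d/du]. Twisting gives [r h_r + B (r - 1) h_(r-1) = r (twist h)_r - B
    h_(r-1)], and [twist h] has lower level, so induction on the level applies. *)
Lemma rational_seq_index (B : C) (h : nat -> C) :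
  rational_seq B h -> rational_seq B (fun r => CofNat r * h r).
Proof.
intros [m H]; revert h H; induction m as [|m IH]; intros h [N H].
- exists O, N; intros n Hn; simpl in *; rewrite H by lia; ring.
- apply rational_seq_twist.
  apply rational_seq_ext with
    (fun r => 1 * (CofNat r * twist B h r) + (- B) * shift_seq h r).
  + intros [|r]; unfold twist; simpl shift_seq;
      rewrite ?CofNat_S, ?CofNat_0; ring.
  + apply rational_seq_linear.
    * apply IH; exists N; intros n Hn; rewrite <- iter_twist_S; auto.
    * apply rational_seq_shift; exists (S m), N; auto.
Qed.

(** By [binom_diff_rec], the twist of the new sequence is built from the old one by index, shift and
    linear combination. *)
Lemma rational_seq_binom_diff_index (A B : C) (f : nat -> C) :
  rational_seq B (binom_diff A B f) ->
  rational_seq B (binom_diff A B (fun k => CofNat k * f k)).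
Proof.
intros H; apply rational_seq_twist.
apply rational_seq_ext with (fun r =>
  1 * (CofNat r * binom_diff A B f r)
  + 1 * (1 * shift_seq (fun r => CofNat r * binom_diff A B f r) r
         + (- A) * shift_seq (binom_diff A B f) r)).
- intros [|r]; unfold twist; simpl shift_seq.
  + unfold binom_diff, Cdiff; rewrite !Csum_O, CofNat_0; ring.
  + rewrite binom_diff_rec; ring.
- repeat apply rational_seq_linear; try apply rational_seq_shift;
    try apply rational_seq_index; exact H.
Qed.

Lemma fl_1 (A B : C) (k : nat) : fl 1 A B k = 1.
Proof. unfold fl; simpl; unfold pochZ; simpl; field. Qed.

Lemma fl_pos (A B : C) (d k : nat) :
  fl (Z.of_nat (S d)) A B k = poch (A + B * CofNat k + 1) d / poch (A + 1) d.
Proof.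
unfold fl; replace (Z.of_nat (S d) - 1)%Z with (Z.of_nat d) by lia.
now rewrite !pochZ_nonneg.
Qed.

(** Raising [d] by one multiplies the weights by [1 + B k / (A + 1 + d)], and [d = 0] is the
    geometric sequence of [1 / (1 + B u)]. *)
Lemma rational_seq_fl (A B : C) (d : nat) :
  poch (A + 1) d <> 0 ->
  rational_seq B (binom_diff A B (fl (Z.of_nat (S d)) A B)).
Proof.
induction d as [|d IH]; intros H.
- apply rational_seq_twist; exists O, O; intros [|n] Hn; [lia|].
  unfold twist; simpl Nat.iter; simpl shift_seq.
  assert (E : forall r, binom_diff A B (fl (Z.of_nat 1) A B) r = Cpow (- B) r).
  { intros r; rewrite <- (binom_diff_1 A); apply binom_diff_ext; intros; apply fl_1. }
  rewrite !E, Cpow_S; ring.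
- rewrite poch_S in H.
  assert (H1 : poch (A + 1) d <> 0) by (intros E; apply H; rewrite E; ring).
  assert (H2 : A + 1 + CofNat d <> 0) by (intros E; apply H; rewrite E; ring).
  specialize (IH H1).
  apply rational_seq_ext with (fun r =>
    1 * binom_diff A B (fl (Z.of_nat (S d)) A B) r
    + B / (A + 1 + CofNat d)
      * binom_diff A B (fun k => CofNat k * fl (Z.of_nat (S d)) A B k) r).
  + intros r; rewrite <- binom_diff_plus; apply binom_diff_ext; intros k _.
    rewrite !fl_pos, !poch_S; field; split; assumption.
  + apply rational_seq_linear; [exact IH|].
    now apply rational_seq_binom_diff_index.
Qed.

Lemma rational_seq_pos (A : C) (d : nat) :
  poch (A + 1) d <> 0 ->
  rational_seq (1 / 2) (transform A (1 / 2)
      (series_coef A (A + CofNat (S d)) (odd_const (Z.of_nat (S d)) A))).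
Proof.
intros H.
eapply rational_seq_ext; [|apply (rational_seq_fl A (1 / 2) d H)].
intros r; rewrite <- transform_binom; unfold transform; apply Csum_ext.
intros k _; now rewrite binom_fl_pos.
Qed.

(** * Polynomial functions, and rational functions from rational sequences *)

Definition is_Cpoly (f : C -> C) : Prop :=
  exists p : list C, forall y, Cpoly_eval p y = f y.

Lemma Cpoly_eval_cons (c : C) (p : list C) (y : C) :
  Cpoly_eval (c :: p) y = c + y * Cpoly_eval p y.
Proof. reflexivity. Qed.

Lemma is_Cpoly_const (c : C) : is_Cpoly (fun _ => c).
Proof. exists [c]; intros y; simpl; ring. Qed.

Lemma is_Cpoly_X : is_Cpoly (fun y => y).
Proof. exists [RtoC 0; RtoC 1]; intros y; simpl; ring. Qed.

Lemma is_Cpoly_plus (f g : C -> C) :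
  is_Cpoly f -> is_Cpoly g -> is_Cpoly (fun y => f y + g y).
Proof.
intros [p Hp] [q Hq].
assert (H : forall p q, exists s, forall y,
          Cpoly_eval s y = Cpoly_eval p y + Cpoly_eval q y).
{ clear; induction p as [|a p IH]; intros q.
  - exists q; intros y; simpl; ring.
  - destruct q as [|b q]; [exists (a :: p); intros y; simpl; ring|].
    destruct (IH q) as [s Hs]; exists (a + b :: s); intros y.
    rewrite !Cpoly_eval_cons, Hs; ring. }
destruct (H p q) as [s Hs]; exists s; intros y; now rewrite Hs, Hp, Hq.
Qed.

Lemma is_Cpoly_scal (c : C) (f : C -> C) :
  is_Cpoly f -> is_Cpoly (fun y => c * f y).
Proof.
intros [p Hp]; exists (map (Cmult c) p); intros y; rewrite <- Hp; clear.
induction p as [|a p IH]; [simpl; ring|].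
simpl map; rewrite !Cpoly_eval_cons, IH; ring.
Qed.

Lemma is_Cpoly_mult (f g : C -> C) :
  is_Cpoly f -> is_Cpoly g -> is_Cpoly (fun y => f y * g y).
Proof.
intros [p Hp] Hg.
assert (H : is_Cpoly (fun y => Cpoly_eval p y * g y)).
{ clear Hp; induction p as [|a p [s IH]].
  - exists nil; intros y; simpl; ring.
  - destruct (is_Cpoly_plus _ _ (is_Cpoly_scal a g Hg)
      (ex_intro _ (RtoC 0 :: s) (fun y => eq_refl))) as [t Ht].
    exists t; intros y; rewrite Ht, !Cpoly_eval_cons, IH; ring. }
destruct H as [s Hs]; exists s; intros y; now rewrite Hs, Hp.
Qed.

Lemma is_Cpoly_pow (f : C -> C) (n : nat) :
  is_Cpoly f -> is_Cpoly (fun y => Cpow (f y) n).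
Proof.
intros H; induction n as [|n IH]; [apply (is_Cpoly_const 1)|].
apply (is_Cpoly_mult f _ H IH).
Qed.

Lemma is_Cpoly_Csum (h : nat -> C) (N : nat) :
  is_Cpoly (fun u => Csum (fun r => h r * Cpow u r) N).
Proof.
induction N as [|N [p Hp]].
- exists [h O]; intros u; rewrite Csum_O; simpl; ring.
- destruct (is_Cpoly_plus _ _ (ex_intro _ p Hp)
    (is_Cpoly_scal (h (S N)) _ (is_Cpoly_pow _ (S N) is_Cpoly_X))) as [q Hq].
  exists q; intros u; rewrite Hq, Csum_S; reflexivity.
Qed.

Lemma is_Cseries_twist (B : C) (h : nat -> C) (u H : C) :
  is_Cseries (fun r => h r * Cpow u r) H ->
  is_Cseries (fun r => twist B h r * Cpow u r) ((1 + B * u) * H).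
Proof.
intros S1.
assert (S2 := is_Cseries_plus _ _ _ _ S1
  (is_Cseries_scal (B * u) _ _ (is_Cseries_shift _ _ S1))).
replace ((1 + B * u) * H) with (H + B * u * H) by ring.
eapply is_Cseries_ext; [|exact S2]; intros [|r]; unfold twist; simpl; ring.
Qed.

Lemma rational_seq_sum (B : C) (h : nat -> C) :
  rational_seq B h ->
  exists (m : nat) (p : list C), forall u H : C,
    is_Cseries (fun r => h r * Cpow u r) H ->
    Cpow (1 + B * u) m * H = Cpoly_eval p u.
Proof.
intros [m Hm]; exists m; revert h Hm; induction m as [|m IH]; intros h [N HN].
- destruct (is_Cpoly_Csum h N) as [p Hp]; exists p; intros u H HS.
  rewrite Hp; simpl; rewrite Cmult_1_l.
  apply (is_Cseries_unique _ _ _ HS), is_Cseries_finite.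
  intros n Hn; simpl in HN; rewrite HN by exact Hn; ring.
- destruct (IH (twist B h)) as [p Hp].
  { exists N; intros n Hn; rewrite <- iter_twist_S; auto. }
  exists p; intros u H HS.
  rewrite <- (Hp u _ (is_Cseries_twist B h u H HS)), Cpow_S; ring.
Qed.

Lemma is_Cpoly_homogenize (p : list C) :
  exists q : list C, forall y : C, y <> 0 ->
    Cpoly_eval q y = Cpow y (length p) * Cpoly_eval p ((1 - y) / y).
Proof.
induction p as [|c p [q Hq]].
- exists nil; intros y _; simpl; ring.
- assert (HP : is_Cpoly (fun y => c * Cpow y (S (length p))
                                  + (1 + (-1) * y) * Cpoly_eval q y)).
  { apply is_Cpoly_plus.
    - apply is_Cpoly_scal, is_Cpoly_pow, is_Cpoly_X.
    - apply is_Cpoly_mult; [|exists q; reflexivity].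
      apply is_Cpoly_plus; [apply is_Cpoly_const|apply is_Cpoly_scal, is_Cpoly_X]. }
  destruct HP as [s Hs]; exists s; intros y Hy.
  rewrite Hs, Hq by exact Hy; simpl length; rewrite Cpow_S, Cpoly_eval_cons.
  field; exact Hy.
Qed.

(** Since [F] is an [epsilon], the chosen pair is known only through [is_F]. One pair has to be
    exhibited; uniqueness of the limits in [A] and of sums then determines, near 1, the value of
    whichever pair was chosen. *)
Lemma F_value (l : Z) (A : C) (w : nat -> C) :
  (forall r, is_fhat l A (1 / 2) r (transform A (1 / 2) w r)) ->
  geom_dominated w ->
  rational_seq (1 / 2) (transform A (1 / 2) w) ->
  exists rho : R, (0 < rho)%R /\ forall y : C, (Cmod (y - 1) < rho)%R ->
    exists S : C,
      is_Cseries (fun k => w k * Cpow ((y - 1) * Cpower y (- (1 / 2))) k) S /\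
      F l A (1 / 2) y = Cpower y (- A) * S.
Proof.
intros Hh Hw Hr.
destruct (transform_series A (1 / 2) w Hw) as [rho [Hrho HS]].
assert (HF : exists pq, is_F l A (1 / 2) pq).
{ destruct (rational_seq_sum _ _ Hr) as [m [p Hp]].
  destruct (is_Cpoly_homogenize p) as [q Hq].
  destruct (is_Cpoly_mult _ _ (ex_intro _ q (fun y => eq_refl))
    (is_Cpoly_pow _ m is_Cpoly_X)) as [num Hnum].
  destruct (is_Cpoly_mult _ _ (is_Cpoly_pow _ (length p) is_Cpoly_X)
    (is_Cpoly_pow _ m (is_Cpoly_scal (1 / 2) _
      (is_Cpoly_plus _ _ is_Cpoly_X (is_Cpoly_const 1))))) as [den Hden].
  (* As [1 + u / 2 = (y + 1) / (2 y)], the relation [(1 + u / 2)^m H = p(u)] reads [H = q(y) y^m /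
     (y^(length p) ((y + 1) / 2)^m)]. *)
  exists (num, den), (transform A (1 / 2) w); split; [exact Hh|].
  apply locally_Cmod; exists (Rmin rho (1 / 2)).
  split; [apply Rmin_glb_lt; lra|]; intros y Hy; simpl fst; simpl snd.
  destruct (HS y (Rlt_le_trans _ _ _ Hy (Rmin_l _ _))) as [S [_ H2]].
  destruct (near_1 y (Rlt_le_trans _ _ _ Hy (Rmin_r _ _))) as [Hre [Hy0 _]].
  assert (Hy1 : 1 / 2 * (y + 1) <> 0).
  { intros E; assert (E1 : y + 1 = 0).
    { replace (y + 1) with (2 * (1 / 2 * (y + 1))) by field; rewrite E; ring. }
    assert (E2 : Re (y + 1) = 0%R) by (rewrite E1; reflexivity).
    simpl in E2; unfold Re in Hre; lra. }
  assert (D0 : Cpow y (length p) * Cpow (1 / 2 * (y + 1)) m <> 0)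
    by (apply Cmult_neq_0; apply Cpow_nz; assumption).
  rewrite Hden; split; [exact D0|].
  rewrite Hnum, Hq, <- (Hp _ _ H2) by exact Hy0.
  replace (1 + 1 / 2 * ((1 - y) / y)) with (1 / 2 * (y + 1) * / y)
    by (field; exact Hy0).
  rewrite (Cpow_mult_l (1 / 2 * (y + 1)) (/ y)), Cpow_inv by exact Hy0.
  set (y1 := 1 / 2 * (y + 1)) in *.
  match goal with |- is_Cseries _ ?v => replace v with (Cpower y (- A) * S) end.
  { exact H2. }
  field; repeat split; try (apply Cpow_nz; assumption). }
apply (epsilon_spec (inhabits (nil, nil))) in HF.
destruct HF as [h [Hh' HL]].
assert (Eh : forall r, h r = transform A (1 / 2) w r).
{ intros r; exact (filterlim_locally'_unique _ _ _ _ (Hh' r) (Hh r)). }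
apply locally_Cmod in HL; destruct HL as [d [Hd HL]].
exists (Rmin rho d); split; [now apply Rmin_glb_lt|]; intros y Hy.
destruct (HS y (Rlt_le_trans _ _ _ Hy (Rmin_l _ _))) as [S [H1 H2]].
exists S; split; [exact H1|].
destruct (HL y (Rlt_le_trans _ _ _ Hy (Rmin_r _ _))) as [_ H3].
unfold F; apply (is_Cseries_unique _ _ _ H3).
eapply is_Cseries_ext; [|exact H2]; intros r; cbv beta; now rewrite Eh.
Qed.

(** * The functions G *)

Lemma poch_neq_0 (b : C) (k : nat) :
  (forall n, b <> - CofNat n) -> poch b k <> 0.
Proof.
intros H; induction k as [|k IH]; [apply C1_nz|].
rewrite poch_S; apply Cmult_neq_0; [exact IH|].
intros E; apply (H k); replace b with (b + CofNat k - CofNat k) by ring.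
rewrite E; ring.
Qed.

Lemma poch_1_fact (k : nat) : poch 1 k = CofNat (fact k).
Proof.
assert (H := poch_nat 0 k); rewrite CofNat_0 in H; simpl (0 + k)%nat in H.
rewrite H; replace (0 + 1) with (RtoC 1) by ring.
change (CofNat (fact 0)) with (RtoC 1); ring.
Qed.

Lemma poch_succ_quot (b : C) (k : nat) :
  b * poch (b + 1) k = poch b k * (b + CofNat k).
Proof. now rewrite <- poch_S_l. Qed.

(** With [g = A + D] and [f] these weights, [B k f = g - g f], so [binom_diff_rec] closes on [h]
    alone; [A] cancels in the coefficient of [h_r], leaving [(g + B (r + 1)) h_(r+1) = - B (D + r)
    h_r]. *)
Lemma binom_diff_arith (A B D : C) (r : nat) :
  B <> 0 -> (forall k, A + D + B * CofNat k <> 0) ->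
  binom_diff A B (fun k => (A + D) / (A + D + B * CofNat k)) r
  = Cpow (-1) r * poch D r / poch ((A + D) / B + 1) r.
Proof.
intros HB H.
assert (He : forall n, (A + D) / B + 1 <> - CofNat n).
{ intros n E; apply (H (S n)); rewrite CofNat_S.
  replace (A + D + B * (CofNat n + 1)) with (B * ((A + D) / B + 1 + CofNat n))
    by (field; exact HB).
  rewrite E; ring. }
set (f := fun k => (A + D) / (A + D + B * CofNat k)).
assert (Hk : forall r, binom_diff A B (fun k => CofNat k * f k) r
  = (A + D) / B * Cpow (- B) r + (- (A + D) / B) * binom_diff A B f r).
{ intros n; rewrite <- (binom_diff_1 A), <- binom_diff_plus.
  apply binom_diff_ext; intros k _; unfold f; field; auto. }
induction r as [|r IH].
- unfold binom_diff, Cdiff; rewrite Csum_O, !binom_0; unfold f.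
  assert (H0 := H O); rewrite CofNat_0 in *; simpl.
  field; rewrite Cmult_0_r, Cplus_0_r in H0; exact H0.
- assert (R := binom_diff_rec A B f r); rewrite !Hk, Cpow_S in R.
  assert (R' : (A + D + B * CofNat (S r)) * binom_diff A B f (S r)
    = - (B * (D + CofNat r)) * binom_diff A B f r).
  { transitivity (B * (CofNat (S r) * binom_diff A B f (S r)
        + (CofNat r - A) * binom_diff A B f r)
      + (A + D) * binom_diff A B f (S r) - B * (CofNat r - A) * binom_diff A B f r);
      [ring|].
    rewrite <- R; field; exact HB. }
  rewrite IH in R'.
  apply (Cmult_cancel_r (A + D + B * CofNat (S r))); [apply H|].
  rewrite Cmult_comm, R', Cpow_S, !poch_S, CofNat_S.
  assert (N1 := poch_neq_0 _ r He).
  assert (N2 : (A + D) / B + 1 + CofNat r <> 0).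
  { intros E; apply (He r).
    replace ((A + D) / B + 1) with ((A + D) / B + 1 + CofNat r - CofNat r) by ring.
    rewrite E; ring. }
  replace (A + D + B * (CofNat r + 1)) with (B * ((A + D) / B + 1 + CofNat r))
    by (field; exact HB).
  set (p := poch ((A + D) / B + 1) r) in *.
  set (q := (A + D) / B + 1 + CofNat r) in *.
  field; split; assumption.
Qed.

Lemma is_Cseries_hypF (aa bb : list C) (z v : C) :
  is_Cseries (fun k => poch_prod aa k / (poch_prod bb k * poch 1 k) * Cpow z k) v ->
  hypF aa bb z = v.
Proof. apply CSeries_unique. Qed.

Definition weighted_coef (l : nat) (A g : C) (k : nat) : C :=
  series_coef A (A + CofNat (S l)) (odd_const (Z.of_nat (S l)) A) k
  * (g / (g + 1 / 2 * CofNat k)).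

Lemma transform_weighted (l : nat) (A g : C) (r : nat) :
  poch (A + 1) l <> 0 ->
  transform A (1 / 2) (weighted_coef l A g) r
  = binom_diff A (1 / 2) (fun k => poch (A + 1 / 2 * CofNat k + 1) l / poch (A + 1) l
                                   * (g / (g + 1 / 2 * CofNat k))) r.
Proof.
intros H; rewrite <- transform_binom; unfold transform; apply Csum_ext.
intros k _; unfold weighted_coef; rewrite <- binom_fl_pos by exact H.
rewrite fl_pos; ring.
Qed.

Lemma half_neq_0 : 1 / 2 <> 0 :> C.
Proof.
intros E; apply C1_nz; replace (RtoC 1) with (2 * (1 / 2)) by field.
rewrite E; ring.
Qed.

Lemma neg_power (y : C) (k : nat) : y <> 0 ->
  Cpow ((y - 1) / y) k = Cpow (-1) k * Cpow ((1 - y) / y) k.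
Proof.
intros Hy; rewrite <- Cpow_mult_l; f_equal; field; exact Hy.
Qed.

Lemma poch_arith_neq_0 (g : C) (k : nat) :
  (forall k, g + 1 / 2 * CofNat k <> 0) -> poch (g / (1 / 2) + 1) k <> 0.
Proof.
intros H; apply poch_neq_0; intros n E; apply (H (S n)); rewrite CofNat_S.
replace (g + 1 / 2 * (CofNat n + 1)) with (1 / 2 * (g / (1 / 2) + 1 + CofNat n)).
- rewrite E; ring.
- field; exact half_neq_0.
Qed.

Lemma G0_value (A D y v : C) :
  (forall k, A + D + 1 / 2 * CofNat k <> 0) -> y <> 0 ->
  is_Cseries (fun r => transform A (1 / 2) (weighted_coef 0 A (A + D)) r
                       * Cpow ((1 - y) / y) r) v ->
  G 0 A (1 / 2) D y = v.
Proof.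
intros H Hy HS; unfold G, G_lower; simpl Z.eqb; cbv iota.
apply is_Cseries_hypF; eapply is_Cseries_ext; [|exact HS]; intros r; cbv beta.
rewrite transform_weighted by apply C1_nz.
rewrite (binom_diff_ext _ _ _ (fun k => (A + D) / (A + D + 1 / 2 * CofNat k)))
  by (intros k _; simpl poch; replace (1 / 1) with (RtoC 1) by field;
      apply Cmult_1_l).
rewrite binom_diff_arith by (exact half_neq_0 || exact H).
rewrite neg_power by exact Hy; simpl poch_prod.
assert (N := poch_arith_neq_0 _ r H).
assert (N1 : poch 1 r <> 0) by (rewrite poch_1_fact; apply fact_neq_0_C).
set (p := poch ((A + D) / (1 / 2) + 1) r) in *.
field; split; assumption.
Qed.

(** With [g = A + D + 1], partial fractions in [k] give [(A + 1 + k / 2) g / (g + k / 2) = g - D g /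
    (g + k / 2)]: a geometric sequence plus one covered by [binom_diff_arith] with [D + 1].
    Multiplying by [1 + u / 2], the inverse of the prefactor of [G_1], removes the geometric part
    beyond [r = 0] and leaves the hypergeometric terms. *)
Lemma G1_value (A D y v : C) :
  (forall k, A + D + 1 + 1 / 2 * CofNat k <> 0) ->
  (forall n, (A + 1) / (1 / 2 - 1) <> - CofNat n) ->
  y <> 0 -> y + 1 <> 0 ->
  is_Cseries (fun r => transform A (1 / 2) (weighted_coef 1 A (A + D + 1)) r
                       * Cpow ((1 - y) / y) r) v ->
  G 1 A (1 / 2) D y = v.
Proof.
intros H Hd Hy Hy1 HS; unfold G, G_lower; simpl Z.eqb; cbv iota.
assert (HA : A + 1 <> 0).
{ intros E; apply (Hd O); rewrite E, CofNat_0; field. }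
set (g := A + D + 1) in *.
set (s := fun r => Cpow (-1) r * poch (D + 1) r / poch (g / (1 / 2) + 1) r).
assert (E : forall r, transform A (1 / 2) (weighted_coef 1 A g) r
  = g / (A + 1) * Cpow (- (1 / 2)) r + (- D / (A + 1)) * s r).
{ intros r; rewrite transform_weighted.
  2:{ simpl; rewrite CofNat_0; intros E; apply HA.
      replace (A + 1) with (1 * (A + 1 + 0)) by ring; exact E. }
  unfold s; replace g with (A + (D + 1)) by (unfold g; ring).
  rewrite <- binom_diff_arith.
  2: exact half_neq_0.
  2:{ intros k; replace (A + (D + 1)) with g by (unfold g; ring); apply H. }
  rewrite <- (binom_diff_1 A), <- binom_diff_plus; apply binom_diff_ext.
  intros k _; simpl poch; rewrite CofNat_0.
  specialize (H k); unfold g in H.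
  unfold g; set (t := 1 / 2 * CofNat k) in *; clearbody t.
  replace (A + (D + 1)) with (A + D + 1) by ring.
  field; split; assumption. }
apply is_Cseries_twist with (B := 1 / 2) in HS.
replace (1 + 1 / 2 * ((1 - y) / y)) with ((y + 1) / (2 * y)) in HS by (field; exact Hy).
assert (EH : hypF [D; (A + 1) / (1 / 2 - 1) + 1; RtoC 1]
  [g / (1 / 2) + 1; (A + 1) / (1 / 2 - 1)] ((y - 1) / y) = (y + 1) / (2 * y) * v).
{ apply is_Cseries_hypF; eapply is_Cseries_ext; [|exact HS]; intros r; cbv beta.
  rewrite neg_power by exact Hy.
  rewrite (Cmult_assoc _ (Cpow (-1) r)); f_equal.
  assert (N := fun r => poch_arith_neq_0 _ r H).
  assert (N1 : poch 1 r <> 0) by (rewrite poch_1_fact; apply fact_neq_0_C).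
  assert (N2 := poch_neq_0 _ r Hd).
  assert (Q := poch_succ_quot ((A + 1) / (1 / 2 - 1)) r).
  set (d := (A + 1) / (1 / 2 - 1)) in *.
  assert (Ed : d = - (2 * (A + 1))).
  { unfold d; field. }
  assert (Hd0 : d <> 0) by (intros E0; apply (Hd O); rewrite E0, CofNat_0; ring).
  (* The upper parameter [d + 1] over the lower [d] contributes only the linear factor
     [(d + r) / d]. *)
  assert (Q' : poch (d + 1) r = poch d r * (d + CofNat r) / d).
  { rewrite <- Q; field; exact Hd0. }
  simpl poch_prod; rewrite Q'.
  destruct r as [|r].
  - unfold twist; simpl shift_seq; rewrite E; unfold s; simpl.
    rewrite CofNat_0; unfold g; field; split; assumption.
  - unfold twist; simpl shift_seq; rewrite !E; unfold s.
    assert (NS := N (S r)); assert (NR := N r).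
    rewrite (poch_S (g / (1 / 2) + 1)), !Cpow_S, (poch_S_l D), (poch_S (D + 1)) in *.
    set (pd := poch d (S r)) in *; rewrite Ed; rewrite CofNat_S in *.
    assert (Eg : g / (1 / 2) = 2 * g) by field.
    rewrite Eg in *.
    assert (NG : 2 * g + 1 + CofNat r <> 0).
    { intros E0; apply NS; rewrite E0; ring. }
    set (p := poch (2 * g + 1) r) in *; set (q := poch (D + 1) r).
    set (m := Cpow (-1) r); set (n := Cpow (- (1 / 2)) r).
    set (p1 := poch 1 (S r)) in *.
    unfold g in *; field; repeat split; assumption. }
rewrite EH; field; split; assumption.
Qed.

(** * Even and odd parts *)

Lemma Cmod_inv_near_1 (s : C) (d : R) :
  (Cmod (s - 1) < 1 / 2)%R -> (Cmod (s - 1) < d / 2)%R -> (Cmod (/ s - 1) < d)%R.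
Proof.
intros H1 H2; destruct (near_1 s H1) as [_ [Hs Hm]].
replace (/ s - 1) with (- (s - 1) / s) by (field; exact Hs).
rewrite Cmod_div, Cmod_opp by exact Hs.
apply Rmult_lt_reg_r with (Cmod s); [lra|].
unfold Rdiv at 1; rewrite Rmult_assoc, Rinv_l by lra.
assert (P := Cmod_ge_0 (s - 1)); nra.
Qed.

(* At [y = 1 / s] and [y = s] the expansion variable [(y - 1) y^(-1/2)] takes
   opposite values [X] and [- X]. *)
Lemma parity_split (a : C) (w : nat -> C) (Phi : C -> C) (rho : R) :
  (0 < rho)%R ->
  (forall y : C, (Cmod (y - 1) < rho)%R -> exists S : C,
      is_Cseries (fun k => w k * Cpow ((y - 1) * Cpower y (- (1 / 2))) k) S /\
      Phi y = Cpower y (- - a) * S) ->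
  locally (T := C_UniformSpace) (RtoC 1) (fun s : C => exists X : C,
    X * X = - (4 * (1 / zeta11 s)) /\
    (s <> 1 -> sqrt_zeta11 s * X = 1) /\
    is_Cseries (fun j => w (2 * j)%nat * Cpow X (2 * j))
      (1 / 2 * (Cpower s a * Phi (/ s) + Cpower s (- a) * Phi s)) /\
    is_Cseries (fun j => w (S (2 * j)) * Cpow X (S (2 * j)))
      (1 / 2 * (Cpower s a * Phi (/ s) - Cpower s (- a) * Phi s))).
Proof.
intros Hrho H; apply locally_Cmod; exists (Rmin (1 / 2) (rho / 2)).
split; [apply Rmin_glb_lt; lra|]; intros s Hs.
assert (Hs1 := Rlt_le_trans _ _ _ Hs (Rmin_l _ _)).
assert (Hs2 := Rlt_le_trans _ _ _ Hs (Rmin_r _ _)).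
destruct (near_1 s Hs1) as [Hre [Hs0 _]].
destruct (H (/ s) (Cmod_inv_near_1 s rho Hs1 Hs2)) as [S1 [HS1 E1]].
destruct (H s ltac:(lra)) as [S2 [HS2 E2]].
assert (Ehalf : Cpower s (1 / 2) * Cpower s (1 / 2) = s).
{ unfold Cpower; rewrite <- Cexp_plus.
  transitivity (Cexp (Clog s)); [f_equal; field|apply Cexp_Clog; lra]. }
assert (Hh0 : Cpower s (1 / 2) <> 0) by apply Cexp_neq_0.
assert (Einv : forall c, Cpower (/ s) c = Cpower s (- c)).
{ intros c; unfold Cpower; rewrite Clog_inv by lra; f_equal; ring. }
assert (Eopp : forall c, Cpower s (- c) = / Cpower s c).
{ intros c; unfold Cpower; rewrite <- Cexp_opp; f_equal; ring. }
set (h := Cpower s (1 / 2)) in *.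
(* The value of [x] at [y = 1 / s] and, off [s = 1], the reciprocal of [sqrt_zeta11 s]. *)
set (X := (1 - s) / h).
exists X.
assert (X1 : (/ s - 1) * Cpower (/ s) (- (1 / 2)) = X).
{ rewrite Einv, Copp_opp; unfold X; fold h; rewrite <- Ehalf.
  field; exact Hh0. }
assert (X2 : (s - 1) * Cpower s (- (1 / 2)) = - X).
{ rewrite Eopp; unfold X; fold h; field; exact Hh0. }
rewrite X1 in HS1; rewrite X2 in HS2.
assert (F1 : Cpower s a * Phi (/ s) = S1).
{ rewrite E1, Einv, !Copp_opp, Cmult_assoc, (Cmult_comm (Cpower s a)).
  rewrite Cpower_opp_mult; ring. }
assert (F2 : Cpower s (- a) * Phi s = S2).
{ rewrite E2, Copp_opp, Cmult_assoc, Cpower_opp_mult; ring. }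
rewrite F1, F2; split; [|split; [|split]].
- unfold X; transitivity ((1 - s) * (1 - s) / s).
  { transitivity ((1 - s) * (1 - s) / (h * h));
      [field; exact Hh0|rewrite Ehalf; reflexivity]. }
  unfold zeta11; simpl Cpow.
  (* At [s = 1] the convention [/ 0 = 0] makes [zeta11] and its reciprocal 0, in agreement with
     [X = 0]. *)
  destruct (Ceq_dec s 1) as [->|Hs3].
  + replace (1 - 1) with (RtoC 0) by ring.
    rewrite !Cmult_0_l; unfold Cdiv; rewrite Cinv_0.
    replace (- (4 * 1 * 0)) with (RtoC 0) by ring; rewrite Cinv_0; ring.
  + assert (1 - s <> 0) by (apply Cminus_eq_contra; auto).
    field; repeat split; auto.
- intros Hs3; unfold sqrt_zeta11, X; fold h.
  assert (1 - s <> 0) by (apply Cminus_eq_contra; auto).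
  field; repeat split; auto.
- exact (even_part w X S1 S2 HS1 HS2).
- exact (odd_part w X S1 S2 HS1 HS2).
Qed.

(** Duplication formula. It produces the lower parameter 1/2, as its odd companion produces 3/2, and
    the factor [4^j] cancels against [x^2 = - 4 z]. *)
Lemma fact_even (j : nat) :
  CofNat (fact (2 * j)) = Cpow 4 j * poch (1 / 2) j * poch 1 j.
Proof.
induction j as [|j IH].
- simpl; change (CofNat 1) with (RtoC 1); ring.
- replace (2 * S j)%nat with (S (S (2 * j))) by lia.
  rewrite !CofNat_fact_S, IH, CofNat_S, CofNat_double, Cpow_S, !poch_S; field.
Qed.

Lemma fact_odd (j : nat) :
  CofNat (fact (S (2 * j))) = Cpow 4 j * poch (1 / 2 + 1) j * poch 1 j.
Proof.
rewrite CofNat_fact_S, fact_even, CofNat_double.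
assert (H := poch_succ_quot (1 / 2) j).
transitivity (Cpow 4 j * poch 1 j * 2 * (poch (1 / 2) j * (1 / 2 + CofNat j)));
  [field|].
rewrite <- H; field.
Qed.

Lemma even_term (A e cst X z : C) (j : nat) :
  X * X = - (4 * z) ->
  series_coef A e cst (2 * j) * Cpow X (2 * j)
  = poch e j * poch (- A) j / (poch (1 / 2) j * poch 1 j) * Cpow z j.
Proof.
intros HX; rewrite series_coef_even, Cpow_mult_r.
replace (Cpow X 2) with ((-1) * 4 * z) by (simpl; rewrite Cmult_1_r, HX; ring).
assert (N := fact_neq_0_C (2 * j)); rewrite fact_even in *.
rewrite !Cpow_mult_l.
assert (S := Cpow_m1_sq j).
transitivity ((Cpow (-1) j * Cpow (-1) j) * (poch e j * poch (- A) j)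
  * Cpow 4 j * Cpow z j / (Cpow 4 j * poch (1 / 2) j * poch 1 j)).
{ unfold Cdiv; ring. }
rewrite S; field; repeat split; intros E; apply N; rewrite E; ring.
Qed.

Lemma odd_term (A e cst X z : C) (j : nat) :
  X * X = - (4 * z) ->
  series_coef A e cst (S (2 * j)) * Cpow X (S (2 * j))
  = cst * X * (poch (e + 1 / 2) j * poch (- A + 1 / 2) j
    / (poch (1 / 2 + 1) j * poch 1 j) * Cpow z j).
Proof.
intros HX; rewrite series_coef_odd, Cpow_S, Cpow_mult_r.
replace (Cpow X 2) with ((-1) * 4 * z) by (simpl; rewrite Cmult_1_r, HX; ring).
assert (N := fact_neq_0_C (S (2 * j))); rewrite fact_odd in *.
rewrite !Cpow_mult_l.
assert (S := Cpow_m1_sq j).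
transitivity ((Cpow (-1) j * Cpow (-1) j)
  * (cst * X * (poch (e + 1 / 2) j * poch (- A + 1 / 2) j))
  * Cpow 4 j * Cpow z j / (Cpow 4 j * poch (1 / 2 + 1) j * poch 1 j)).
{ unfold Cdiv; ring. }
rewrite S; field; repeat split; intros E; apply N; rewrite E; ring.
Qed.

(** This makes the prefactor for [kappa = 1] the reciprocal of [w_1] at [A = - a]. Reflecting the
    two symbols produces the signs [(-1)^(d + 1)] and [(-1)^d], whose quotient accounts for the
    leading minus. *)
Lemma odd_const_pos_value (a : C) (d : nat) :
  poch (a + 1 / 2 - CofNat (S d)) (S d) <> 0 -> poch (a - CofNat d) d <> 0 ->
  - pochZ (a + 1 / 2) (- Z.of_nat (S d)) * odd_const (Z.of_nat (S d)) (- a)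
  = pochZ a (- Z.of_nat d).
Proof.
intros H1 H2; unfold odd_const.
replace (Z.of_nat (S d) - 1)%Z with (Z.of_nat d) by lia.
rewrite !pochZ_nonneg, !pochZ_nonpos.
replace (- a + 1 / 2) with (- (a - 1 / 2)) by ring.
replace (- a + 1) with (- (a - 1)) by ring.
rewrite !poch_opp.
replace (a - 1 / 2 - CofNat (S d) + 1) with (a + 1 / 2 - CofNat (S d)) by field.
replace (a - 1 - CofNat d + 1) with (a - CofNat d) by ring.
rewrite Cpow_S.
assert (N : Cpow (-1) d <> 0).
{ intros E; apply C1_nz; rewrite <- (Cpow_m1_sq d), E; ring. }
field; repeat split; assumption.
Qed.

Lemma odd_const_nonpos_value (a : C) (n : nat) :
  poch (- a + (1 / 2 - CofNat n)) n <> 0 -> poch a (S n) <> 0 ->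
  - pochZ (a + 1 / 2) (Z.of_nat n) * odd_const (- Z.of_nat n) (- a)
  = pochZ a (Z.of_nat (S n)).
Proof.
intros H1 H2; rewrite odd_const_nonpos, !pochZ_nonneg.
replace (a + 1 / 2) with (- (- a - 1 / 2)) by ring.
rewrite poch_opp.
replace (- a - 1 / 2 - CofNat n + 1) with (- a + (1 / 2 - CofNat n)) by field.
assert (E := poch_opp (- a) (S n)); rewrite Copp_opp in E.
replace (- a - CofNat (S n) + 1) with (- a + - CofNat n) in E
  by (rewrite CofNat_S; ring).
rewrite Cpow_S in E; rewrite E in *.
assert (N : poch (- a + - CofNat n) (S n) <> 0).
{ intros E0; apply H2; rewrite E0; ring. }
field; split; assumption.
Qed.

(** Because [/ 0 = 0], a nonzero value certifies that the inverted symbol was nonzero. *)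
Lemma pochZ_nonpos_neq_0 (c : C) (n : nat) :
  pochZ c (- Z.of_nat n) <> 0 -> poch (c - CofNat n) n <> 0.
Proof.
intros H E; apply H; rewrite pochZ_nonpos, E; apply Cinv_0.
Qed.

Lemma pochZ_defined_nonpos (c : C) (n : nat) :
  pochZ_defined c (- Z.of_nat n) -> poch (c - CofNat n) n <> 0.
Proof.
intros H; destruct n as [|n]; [apply C1_nz|].
unfold pochZ_defined in H; rewrite Z.opp_involutive, Nat2Z.id, CofZ_opp,
  CofZ_of_nat in H.
apply H; lia.
Qed.

Lemma poch_opp_neq_0 (a : C) (d : nat) :
  poch (a - CofNat d) d <> 0 -> poch (- a + 1) d <> 0.
Proof.
intros H E; apply H.
replace (a - CofNat d) with (a - 1 - CofNat d + 1) by ring.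
rewrite <- poch_opp_reflect.
replace (- (a - 1)) with (- a + 1) by ring; rewrite E; ring.
Qed.

Lemma Z_pos_or_nonpos (l : Z) :
  (exists d, l = Z.of_nat (S d)) \/ (exists n, l = (- Z.of_nat n)%Z).
Proof.
destruct (Z_lt_le_dec 0 l).
- left; exists (Z.to_nat (l - 1)); lia.
- right; exists (Z.to_nat (- l)); lia.
Qed.

(** * Expansions of F and G, and the two identities *)

Definition F_coef (l : Z) (a : C) : nat -> C :=
  series_coef (- a) (- a + CofZ l) (odd_const l (- a)).

Lemma F_expansion (a : C) (l : Z) :
  pochZ a (1 - l) <> 0 -> F_defined l (- a) (1 / 2) ->
  exists rho : R, (0 < rho)%R /\ forall y : C, (Cmod (y - 1) < rho)%R ->
    exists S : C,
      is_Cseries (fun k => F_coef l a k * Cpow ((y - 1) * Cpower y (- (1 / 2))) k) S /\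
      F l (- a) (1 / 2) y = Cpower y (- - a) * S.
Proof.
intros Ha HF; unfold F_coef.
destruct (Z_pos_or_nonpos l) as [[d ->]|[n ->]].
- replace (1 - Z.of_nat (S d))%Z with (- Z.of_nat d)%Z in Ha by lia.
  apply pochZ_nonpos_neq_0, poch_opp_neq_0 in Ha.
  rewrite CofZ_of_nat; apply F_value.
  + intros r; now apply is_fhat_pos.
  + apply geom_dominated_series_coef.
  + now apply rational_seq_pos.
- replace (1 - - Z.of_nat n)%Z with (Z.of_nat (S n)) in Ha by lia.
  rewrite pochZ_nonneg in Ha.
  assert (H1 : poch (- a - CofNat n) (S n) <> 0).
  { intros E; apply Ha.
    replace a with (- - a) by ring; rewrite poch_opp, CofNat_S.
    replace (- a - (CofNat n + 1) + 1) with (- a - CofNat n) by ring.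
    rewrite E; ring. }
  assert (H2 := F_defined_odd_const (- a) n H1 HF).
  rewrite CofZ_opp, CofZ_of_nat; apply F_value.
  + intros r; now apply is_fhat_nonpos.
  + apply geom_dominated_series_coef.
  (* For [l = - n] the generating function is a polynomial in [u] of degree at most [n]: level 0
     with cut-off [n]. *)
  + exists O, n; intros r Hr; now apply transform_nonpos_0.
Qed.

(** The condition on [F_defined] is restricted to [l <= 0] because the identity for [G] also relies
    on this, at the positive index [l + 1]. *)
Lemma odd_const_value (a : C) (l : Z) :
  pochZ_defined (a + 1 / 2) (- l) -> pochZ a (1 - l) <> 0 ->
  ((l <= 0)%Z -> F_defined l (- a) (1 / 2)) ->
  - pochZ (a + 1 / 2) (- l) * odd_const l (- a) = pochZ a (1 - l).
Proof.
intros H1 Ha HF.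
destruct (Z_pos_or_nonpos l) as [[d ->]|[n ->]].
- replace (1 - Z.of_nat (S d))%Z with (- Z.of_nat d)%Z in * by lia.
  apply odd_const_pos_value.
  + now apply pochZ_defined_nonpos.
  + now apply pochZ_nonpos_neq_0.
- replace (1 - - Z.of_nat n)%Z with (Z.of_nat (S n)) in * by lia.
  rewrite Z.opp_involutive; rewrite pochZ_nonneg in Ha.
  apply odd_const_nonpos_value; [|exact Ha].
  apply F_defined_odd_const; [|apply HF; lia].
  intros E; apply Ha.
  replace a with (- - a) by ring; rewrite poch_opp, CofNat_S.
  replace (- a - (CofNat n + 1) + 1) with (- a - CofNat n) by ring.
  rewrite E; ring.
Qed.

Lemma half_of_1 : CofNat 1 / 2 = 1 / 2.
Proof. reflexivity. Qed.

Lemma half_of_0 : CofNat 0 / 2 = 0.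
Proof. rewrite CofNat_0; field. Qed.

Lemma hypF_F (a : C) (l : Z) (kappa : nat) :
  (kappa = 0%nat \/ kappa = 1%nat) ->
  let k2 : C := CofNat kappa / 2 in
  let kZ : Z := Z.of_nat kappa in
  pochZ_defined (a + k2) (1 - l - kZ) ->
  pochZ a (1 - l) <> 0 ->
  F_defined l (- a) (1 / 2) ->
  locally (T := C_UniformSpace) (RtoC 1) (fun s : C =>
    (s <> 1 \/ kappa = 0%nat) ->
    hypF [- a + CofZ l + k2; a + k2] [1 / 2 + CofNat kappa] (1 / zeta11 s)
    = Cpow (-1) kappa * pochZ (a + k2) (1 - l - kZ) / pochZ a (1 - l)
      * Cpow (sqrt_zeta11 s) kappa
      * (1 / 2 * (Cpower s a * F l (- a) (1 / 2) (/ s)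
                  + Cpow (-1) kappa * Cpower s (- a) * F l (- a) (1 / 2) s))).
Proof.
intros Hk k2 kZ H1 Ha HF.
destruct (F_expansion a l Ha HF) as [rho [Hrho HS]].
generalize (parity_split a _ _ rho Hrho HS); apply filter_imp.
intros s [X [HX [Hsq [HE HO]]]] Hs; unfold F_coef in HE, HO.
destruct Hk as [-> | ->]; unfold k2, kZ in *; clear k2 kZ.
- rewrite half_of_0, !Cplus_0_r, Z.sub_0_r; simpl Cpow.
  transitivity (1 / 2 * (Cpower s a * F l (- a) (1 / 2) (/ s)
                         + Cpower s (- a) * F l (- a) (1 / 2) s)).
  + apply is_Cseries_hypF; eapply is_Cseries_ext; [|exact HE].
    intros j; cbv beta; rewrite (even_term _ _ _ _ _ j HX), Copp_opp.
    simpl poch_prod; rewrite !Cmult_1_r; reflexivity.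
  + field; exact Ha.
- rewrite half_of_1 in *.
  replace (1 - l - Z.of_nat 1)%Z with (- l)%Z in * by lia.
  assert (Hs1 : s <> 1 :> C) by (destruct Hs as [Hs|Hs]; [exact Hs|discriminate]).
  specialize (Hsq Hs1).
  assert (Hc := odd_const_value a l H1 Ha (fun _ => HF)).
  change (CofNat 1) with (RtoC 1).
  set (cst := odd_const l (- a)) in *; set (p := pochZ (a + 1 / 2) (- l)) in *.
  (* This scalar is [1 / w_1] times [1 / X]; it turns the common factor [cst * X] of the odd terms
     into 1. *)
  apply (is_Cseries_scal (- p / pochZ a (1 - l) * sqrt_zeta11 s)) in HO.
  transitivity (- p / pochZ a (1 - l) * sqrt_zeta11 s
    * (1 / 2 * (Cpower s a * F l (- a) (1 / 2) (/ s)
                - Cpower s (- a) * F l (- a) (1 / 2) s))).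
  + apply is_Cseries_hypF; eapply is_Cseries_ext; [|exact HO].
    intros j; cbv beta; rewrite (odd_term _ _ _ _ _ j HX), Copp_opp.
    simpl poch_prod; rewrite !Cmult_1_r.
    rewrite Cmult_assoc.
    replace (- p / pochZ a (1 - l) * sqrt_zeta11 s * (cst * X))
      with ((- p * cst) * (sqrt_zeta11 s * X) / pochZ a (1 - l))
      by (unfold Cdiv; ring).
    rewrite Hc, Hsq.
    replace (pochZ a (1 - l) * 1 / pochZ a (1 - l)) with (RtoC 1)
      by (field; exact Ha).
    apply Cmult_1_l.
  + simpl Cpow; unfold Cdiv; ring.
Qed.

Lemma G_expansion (l : nat) (A D : C) :
  (l = 0%nat \/ l = 1%nat) ->
  (forall k, A + D + CofNat l + 1 / 2 * CofNat k <> 0) ->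
  (l = 1%nat -> forall n, (A + 1) / (1 / 2 - 1) <> - CofNat n) ->
  exists rho : R, (0 < rho)%R /\ forall y : C, (Cmod (y - 1) < rho)%R ->
    exists S : C,
      is_Cseries (fun k => weighted_coef l A (A + D + CofNat l) k
                           * Cpow ((y - 1) * Cpower y (- (1 / 2))) k) S /\
      G (Z.of_nat l) A (1 / 2) D y = Cpower y (- A) * S.
Proof.
intros Hl H Hd.
destruct (bounded_inv_arith _ H) as [M HM].
destruct (transform_series A (1 / 2) (weighted_coef l A (A + D + CofNat l)))
  as [rho [Hrho HS]].
{ apply geom_dominated_mult_bounded with M; [|exact HM].
  apply geom_dominated_series_coef. }
exists (Rmin rho (1 / 2)); split; [apply Rmin_glb_lt; lra|]; intros y Hy.
destruct (HS y (Rlt_le_trans _ _ _ Hy (Rmin_l _ _))) as [S [H1 H2]].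
destruct (near_1 y (Rlt_le_trans _ _ _ Hy (Rmin_r _ _))) as [Hre [Hy0 _]].
exists S; split; [exact H1|].
destruct Hl as [-> | ->].
- rewrite CofNat_0, Cplus_0_r in H2.
  apply G0_value; [|exact Hy0|exact H2].
  intros k; specialize (H k); rewrite CofNat_0, Cplus_0_r in H; exact H.
- apply G1_value; [exact H|now apply Hd|exact Hy0| |exact H2].
  intros E; assert (E2 : Re (y + 1) = 0%R) by (rewrite E; reflexivity).
  simpl in E2; unfold Re in Hre; lra.
Qed.

Lemma poch_ratio (b : C) (k : nat) :
  (forall n, b + 1 <> - CofNat n) ->
  b * poch (b + 1) k = poch b k * (b + CofNat k) /\ poch (b + 1) k <> 0.
Proof. intros H; split; [apply poch_succ_quot|now apply poch_neq_0]. Qed.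

Lemma hypF_G (a c : C) (l kappa : nat) :
  (l = 0%nat \/ l = 1%nat) ->
  (kappa = 0%nat \/ kappa = 1%nat) ->
  let k2 : C := CofNat kappa / 2 in
  let kZ : Z := Z.of_nat kappa in
  (forall n, - a - c + CofNat l + 1 + k2 <> - CofNat n) ->
  (forall k, - a + - c + CofNat l + 1 / 2 * CofNat k <> 0) ->
  (l = 1%nat -> forall n, (- a + 1) / (1 / 2 - 1) <> - CofNat n) ->
  pochZ_defined (a + k2) (- Z.of_nat l - kZ) ->
  pochZ a (- Z.of_nat l) <> 0 ->
  a + c - CofNat l <> 0 ->
  locally (T := C_UniformSpace) (RtoC 1) (fun s : C =>
    (s <> 1 \/ kappa = 0%nat) ->
    hypF [- a + CofNat l + 1 + k2; a + k2; - a - c + CofNat l + k2]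
         [1 / 2 + CofNat kappa; - a - c + CofNat l + 1 + k2] (1 / zeta11 s)
    = Cpow (-1) kappa * pochZ (a + k2) (- Z.of_nat l - kZ) * (a + c - CofNat l - k2)
      / (pochZ a (- Z.of_nat l) * (a + c - CofNat l))
      * Cpow (sqrt_zeta11 s) kappa
      * (1 / 2 * (Cpower s a * G (Z.of_nat l) (- a) (1 / 2) (- c) (/ s)
                  + Cpow (-1) kappa * Cpower s (- a)
                    * G (Z.of_nat l) (- a) (1 / 2) (- c) s))).
Proof.
intros Hl Hk k2 kZ Hlow Hg Hd H1 Ha Hac.
destruct (G_expansion l (- a) (- c) Hl Hg Hd) as [rho [Hrho HS]].
generalize (parity_split a _ _ rho Hrho HS); apply filter_imp.
intros s [X [HX [Hsq [HE HO]]]] Hs; unfold weighted_coef in HE, HO.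
set (g := - a + - c + CofNat l) in *.
replace (- a - c + CofNat l) with g in * by (unfold g; ring).
replace (a + c - CofNat l) with (- g) in * by (unfold g; ring).
assert (Hg0 : g <> 0) by (intros E; apply Hac; rewrite E; ring).
destruct Hk as [-> | ->]; unfold k2, kZ in *; clear k2 kZ.
- rewrite half_of_0, !Cplus_0_r, Z.sub_0_r in *; simpl Cpow.
  transitivity (1 / 2 * (Cpower s a * G (Z.of_nat l) (- a) (1 / 2) (- c) (/ s)
                         + Cpower s (- a) * G (Z.of_nat l) (- a) (1 / 2) (- c) s)).
  + apply is_Cseries_hypF; eapply is_Cseries_ext; [|exact HE].
    intros j; cbv beta.
    transitivity (series_coef (- a) (- a + CofNat (S l))
        (odd_const (Z.of_nat (S l)) (- a)) (2 * j) * Cpow X (2 * j)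
      * (g / (g + 1 / 2 * CofNat (2 * j)))); [ring|].
    rewrite (even_term _ _ _ _ _ j HX), Copp_opp.
    destruct (poch_ratio g j Hlow) as [E1 E2].
    assert (E3 := Hg (2 * j)%nat).
    assert (E4 : g + 1 / 2 * CofNat (2 * j) = g + CofNat j).
    { rewrite CofNat_double; field. }
    rewrite E4 in *.
    simpl poch_prod; rewrite !Cmult_1_r.
    (* The parameter [g] over [g + 1] contributes [g / (g + j)], the weight at [k = 2 j]. *)
    replace (poch g j) with (g * poch (g + 1) j / (g + CofNat j))
      by (rewrite E1; field; exact E3).
    rewrite CofNat_S; replace (- a + CofNat l + 1) with (- a + (CofNat l + 1)) by ring.
    assert (NF := fact_neq_0_C (2 * j)); rewrite fact_even in NF.
    set (p1 := poch 1 j) in *; set (ph := poch (1 / 2) j) in *.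
    assert (p1 <> 0) by (intros E; apply NF; rewrite E; ring).
    assert (ph <> 0) by (intros E; apply NF; rewrite E; ring).
    field; repeat split; assumption.
  + field; split; assumption.
- rewrite half_of_1 in *.
  assert (Hs1 : s <> 1 :> C) by (destruct Hs as [Hs|Hs]; [exact Hs|discriminate]).
  specialize (Hsq Hs1).
  assert (Hc := odd_const_value a (Z.of_nat (S l))).
  replace (1 - Z.of_nat (S l))%Z with (- Z.of_nat l)%Z in Hc by lia.
  replace (- Z.of_nat l - Z.of_nat 1)%Z with (- Z.of_nat (S l))%Z in * by lia.
  specialize (Hc H1 Ha ltac:(lia)).
  change (CofNat 1) with (RtoC 1).
  set (cst := odd_const (Z.of_nat (S l)) (- a)) in *.
  set (p := pochZ (a + 1 / 2) (- Z.of_nat (S l))) in *.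
  set (q := pochZ a (- Z.of_nat l)) in *.
  set (h := g + 1 / 2) in *.
  assert (Hh0 : h <> 0).
  { assert (E := Hg 1%nat); change (CofNat 1) with (RtoC 1) in E.
    rewrite Cmult_1_r in E; exact E. }
  replace (- g - 1 / 2) with (- h) by (unfold h; ring).
  replace (g + 1 + 1 / 2) with (h + 1) in * by (unfold h; ring).
  (* The weight at [k = 2 j + 1] is [g / (h + j) = (g / h) (h / (h + j))]. The last factor is the
     parameter [h] over [h + 1]; the first is compensated by [h / g], the quotient
     [(a + c - l - 1/2) / (a + c - l)] of the theorem. *)
  apply (is_Cseries_scal (- p * h / (q * g) * sqrt_zeta11 s)) in HO.
  transitivity (- p * h / (q * g) * sqrt_zeta11 s
    * (1 / 2 * (Cpower s a * G (Z.of_nat l) (- a) (1 / 2) (- c) (/ s)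
                - Cpower s (- a) * G (Z.of_nat l) (- a) (1 / 2) (- c) s))).
  + apply is_Cseries_hypF; eapply is_Cseries_ext; [|exact HO].
    intros j; cbv beta.
    transitivity (- p * h / (q * g) * sqrt_zeta11 s
      * (series_coef (- a) (- a + CofNat (S l)) cst (S (2 * j)) * Cpow X (S (2 * j))
         * (g / (g + 1 / 2 * CofNat (S (2 * j)))))); [ring|].
    rewrite (odd_term _ _ _ _ _ j HX), Copp_opp.
    destruct (poch_ratio h j Hlow) as [E1 E2].
    assert (E3 := Hg (S (2 * j))%nat).
    assert (E4 : g + 1 / 2 * CofNat (S (2 * j)) = h + CofNat j).
    { rewrite CofNat_S, CofNat_double; unfold h; field. }
    rewrite E4 in *.
    simpl poch_prod; rewrite !Cmult_1_r.
    replace (poch h j) with (h * poch (h + 1) j / (h + CofNat j))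
      by (rewrite E1; field; exact E3).
    rewrite CofNat_S.
    replace (- a + CofNat l + 1 + 1 / 2) with (- a + (CofNat l + 1) + 1 / 2) by ring.
    assert (NF := fact_neq_0_C (S (2 * j))); rewrite fact_odd in NF.
    set (p1 := poch 1 j) in *; set (ph := poch (1 / 2 + 1) j) in *.
    assert (p1 <> 0) by (intros E; apply NF; rewrite E; ring).
    assert (ph <> 0) by (intros E; apply NF; rewrite E; ring).
    set (u1 := poch (- a + (CofNat l + 1) + 1 / 2) j).
    set (u2 := poch (a + 1 / 2) j); set (z := Cpow (1 / zeta11 s) j).
    transitivity ((- p * cst) * (sqrt_zeta11 s * X) / q
      * (h / (h + CofNat j) * (u1 * u2 / (ph * p1) * z))).
    { clearbody h u1 u2 z; field; repeat split; assumption. }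
    rewrite Hc, Hsq; clearbody h; field; repeat split; assumption.
  + simpl Cpow; clearbody h; field; split; assumption.
Qed.

(** That the lower parameter [(A + D + l) / B + 1] avoids [- n] settles the index [k = n + 1]; the
    index [k = 0] is the separate non-vanishing hypothesis. *)
Lemma G_lower_arith (l : nat) (A D : C) :
  (l = 0%nat \/ l = 1%nat) -> A + D + CofNat l <> 0 ->
  lower_ok (G_lower (Z.of_nat l) A (1 / 2) D) ->
  (forall k, A + D + CofNat l + 1 / 2 * CofNat k <> 0) /\
  (l = 1%nat -> forall n, (A + 1) / (1 / 2 - 1) <> - CofNat n).
Proof.
intros Hl H0 H.
assert (H1 : forall n, (A + D + CofNat l) / (1 / 2) + 1 <> - CofNat n).
{ apply H; destruct Hl as [-> | ->]; left; rewrite ?CofNat_0, ?Cplus_0_r; reflexivity. }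
split.
- intros [|k]; [rewrite CofNat_0, Cmult_0_r, Cplus_0_r; exact H0|].
  intros E; apply (H1 k); rewrite CofNat_S in E.
  replace ((A + D + CofNat l) / (1 / 2) + 1)
    with (2 * (A + D + CofNat l + 1 / 2 * (CofNat k + 1)) - CofNat k) by field.
  rewrite E; ring.
- intros ->; apply H; right; left; reflexivity.
Qed.

Theorem theorem7p2 :
  (forall (a : C) (l : Z) (kappa : nat),
    (kappa = 0%nat \/ kappa = 1%nat) ->
    let k2 : C := CofNat kappa / 2 in
    let kZ : Z := Z.of_nat kappa in
    lower_ok [1 / 2 + CofNat kappa] ->
    pochZ_defined (a + k2) (1 - l - kZ) ->
    pochZ_defined a (1 - l) ->
    pochZ a (1 - l) <> 0 ->
    F_defined l (- a) (1 / 2) ->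
    locally (T := C_UniformSpace) (RtoC 1) (fun s : C =>
      (s <> 1 \/ kappa = 0%nat) ->
      hypF [- a + CofZ l + k2; a + k2] [1 / 2 + CofNat kappa] (1 / zeta11 s)
      = Cpow (-1) kappa * pochZ (a + k2) (1 - l - kZ) / pochZ a (1 - l)
        * Cpow (sqrt_zeta11 s) kappa
        * (1 / 2 * (Cpower s a * F l (- a) (1 / 2) (/ s)
                    + Cpow (-1) kappa * Cpower s (- a) * F l (- a) (1 / 2) s))))
  /\
  (forall (a c : C) (l : Z) (kappa : nat),
    (l = 0%Z \/ l = 1%Z) ->
    (kappa = 0%nat \/ kappa = 1%nat) ->
    let k2 : C := CofNat kappa / 2 in
    let kZ : Z := Z.of_nat kappa in
    lower_ok [1 / 2 + CofNat kappa; - a - c + CofZ l + 1 + k2] ->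
    lower_ok (G_lower l (- a) (1 / 2) (- c)) ->
    pochZ_defined (a + k2) (- l - kZ) ->
    pochZ_defined a (- l) ->
    pochZ a (- l) <> 0 ->
    a + c - CofZ l <> 0 ->
    locally (T := C_UniformSpace) (RtoC 1) (fun s : C =>
      (s <> 1 \/ kappa = 0%nat) ->
      hypF [- a + CofZ l + 1 + k2; a + k2; - a - c + CofZ l + k2]
           [1 / 2 + CofNat kappa; - a - c + CofZ l + 1 + k2] (1 / zeta11 s)
      = Cpow (-1) kappa * pochZ (a + k2) (- l - kZ) * (a + c - CofZ l - k2)
        / (pochZ a (- l) * (a + c - CofZ l))
        * Cpow (sqrt_zeta11 s) kappa
        * (1 / 2 * (Cpower s a * G l (- a) (1 / 2) (- c) (/ s)
                    + Cpow (-1) kappa * Cpower s (- a)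
                      * G l (- a) (1 / 2) (- c) s)))).
Proof.
split.
- intros a l kappa Hk k2 kZ _ H1 _ Ha HF.
  exact (hypF_F a l kappa Hk H1 Ha HF).
- intros a c l kappa Hl Hk k2 kZ Hlow HG H1 _ Ha Hac.
  assert (HL : exists n : nat, l = Z.of_nat n /\ (n = 0%nat \/ n = 1%nat)).
  { destruct Hl as [-> | ->]; [exists 0%nat|exists 1%nat]; auto. }
  destruct HL as [n [-> Hn]]; rewrite CofZ_of_nat in *.
  destruct (G_lower_arith n (- a) (- c) Hn) as [Hg Hd].
  { intros E; apply Hac.
    replace (a + c - CofNat n) with (- (- a + - c + CofNat n)) by ring.
    rewrite E; ring. }
  { exact HG. }
  refine (hypF_G a c n kappa Hn Hk _ Hg Hd H1 Ha Hac).
  apply Hlow; right; left; reflexivity.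
Qed.
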